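(* For every $\varepsilon>0$ there exist constants $C(\varepsilon)>0$ and $p_0(\varepsilon)$ such that for every prime $p>p_0(\varepsilon)$ and every integer $\lambda$ the congruence $$\sum_{i=1}^{16}\tau(n_i)\equiv\lambda\pmod p$$ is solvable in positive integers $n_1,\ldots,n_{16}$ with $$\max_{1\le i\le 16} n_i\le C(\varepsilon)\,p^{3+\varepsilon}.$$
   Context: $\tau(n)$ denotes the Ramanujan $\tau$-function, defined by the formal power series identity $X\prod_{n=1}^{\infty}(1-X^n)^{24}=\sum_{n=1}^{\infty}\tau(n)X^n$. *)

(* Defs.v *)
From HB Require Import structures.
From mathcomp Require Import all_boot all_order all_algebra.
From mathcomp Require Import reals exp.

Set Implicit Arguments.
Unset Strict Implicit.
Unset Printing Implicit Defensive.

Import Order.TTheory GRing.Theory Num.Theory.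
Local Open Scope ring_scope.

Definition discriminant_trunc (N : nat) : {poly int} :=
  'X * \prod_(1 <= k < N.+1) (1 - 'X^k) ^+ 24.

(* The factors with k >= n do not affect the coefficient of X^n, so it can be
   read off any partial product with N >= n factors: see [tau_truncE]. *)
Definition tau (n : nat) : int := (discriminant_trunc n)`_n.

Lemma tau_truncE (n N : nat) : (n <= N)%N -> (discriminant_trunc N)`_n = tau n.
Proof.
move=> /subnKC <-; elim: (N - n)%N => [|m IHm]; first by rewrite addn0.
rewrite -IHm addnS /discriminant_trunc big_nat_recr //= mulrA.
have [q ->] : exists q : {poly int},
    (1 - 'X^((n + m).+1)) ^+ 24 = 1 + q * 'X^((n + m).+1).
  elim: 24%N => [|e [q IHe]]; first by exists 0; rewrite expr0 mul0r addr0.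
  exists (q * (1 - 'X^((n + m).+1)) - 1).
  rewrite exprSr IHe [LHS]mulrDl mul1r [in RHS]mulrDl mulN1r mulrAC -addrA.
  by congr (1 + _); rewrite addrC.
by rewrite mulrDr mulr1 coefD mulrA coefMXn ltnS leq_addr addr0.
Qed.

(* Main.v *)
(* Hecke relations.  For an even period polynomial P of degree 10 the sums of P
   over Farey paths from the direction e1 to a direction v form a cocycle
   [psi P v] of SL2(Z).  Summing this cocycle over the q + 1 sublattices of prime
   index q gives the cocycle of another such polynomial, and the even period
   polynomials of degree 10 form a plane spanned by [cusp_period] and
   [eis_period].  Evaluating at the directions (b, a) with 0 <= b < a turns this
   into a Hecke relation for the divisor sums of [wsum cusp_period].  Skoruppa's
   rearrangement of the quadruples with a d + b c = n expresses those sums, and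
   the Eisenstein identities E4^2 = E8, 3 D E4 = E2 E4 - E6 and
   2 D E6 = E2 E6 - E4^2, through convolutions of divisor functions; the
   identities give D (E4^3 - E6^2) = E2 (E4^3 - E6^2), the equation of the product
   defining tau.  The outcome is Manin's formula
   691 sum_(d | n) wsum(d) = 36 (sigma_11(n) - tau(n)),
   so that tau(q n) + q^11 tau(n/q) = tau(q) tau(n) for every prime q.

   Waring problem.  If 8 p <= |A| |B| in F_p then every residue is a sum of eight
   products a b (Glibichuk).  As tau(q)^2 - tau(q^2) = q^11, primes q <= p give
   about p / log p distinct pairs (tau(q), tau(q^2)).  If tau has few collisions
   modulo p on the primes, take A to be its set of values and B a polylogarithmic
   set of values at small arguments.  Otherwise tau(q) = tau(q') mod p for many
   pairs, so U = {tau(q)^2} consists of values tau(q q').  With V = {tau(q^2)} and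
   X = {tau(r)} either |V + V| |X| >= 8 p, or Ruzsa's inequality
   |U - V| |V| <= |U + V| |V + V| makes U + V nearly as large as
   U - V, which contains the 11th powers of the primes q; both cases use 8 * 2 = 16
   values of tau. *)

Require Import Defs.
From HB Require Import structures.
From mathcomp Require Import all_boot all_order all_algebra.
From mathcomp Require Import reals exp.
From mathcomp Require Import zify ring lra.

Set Implicit Arguments.
Unset Strict Implicit.
Unset Printing Implicit Defensive.

(** * A lower bound for the number of primes *)

Definition prime_list (N : nat) : seq nat := [seq q <- iota 1 N | prime q].

Lemma mem_prime_list N q : (q \in prime_list N) = prime q && (q <= N).
Proof.
rewrite mem_filter mem_iota; case: (boolP (prime q)) => //= /prime_gt0 ->.
by rewrite add1n ltnS.
Qed.

Lemma central_bin_ge n : 2 ^ n <= 'C(n.*2, n).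
Proof.
elim: n => // n IH; rewrite doubleS binS expnS mul2n -addnn.
apply: leq_add; apply: (leq_trans IH); first by rewrite binS leq_addl.
case: n {IH} => // n; rewrite binS; exact: leq_addr.
Qed.

(** By Legendre's formula the exponent is a sum over k of [2n / q^k] - 2 [n / q^k]; each term is 0
    or 1, and it is 0 once q^k exceeds 2n. *)
Lemma logn_central_bin q n : prime q -> 0 < n ->
  q ^ logn q 'C(n.*2, n) <= n.*2.
Proof.
move=> qp n0; have q1 := prime_gt1 qp.
have n20 : 0 < n.*2 by rewrite double_gt0.
have le2n : n <= n.*2 by rewrite -addnn leq_addr.
have hb := bin_fact le2n; rewrite (_ : n.*2 - n = n) in hb; last by rewrite -addnn addnK.
have h : logn q 'C(n.*2, n) + (logn q n`! + logn q n`!) = logn q (n.*2)`!.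
  by rewrite -hb !lognM ?muln_gt0 ?fact_gt0 ?bin_gt0.
apply: (@leq_trans (q ^ trunc_log q n.*2)); last exact: trunc_logP.
rewrite leq_exp2l // -(leq_add2r (logn q n`! + logn q n`!)) h.
rewrite !logn_fact //.
have ext : \sum_(1 <= k < n.+1) n %/ q ^ k = \sum_(1 <= k < n.*2.+1) n %/ q ^ k.
  rewrite (@big_cat_nat _ _ _ n.+1 1 n.*2.+1) //=.
  have -> : \sum_(n.+1 <= k < n.*2.+1) n %/ q ^ k = 0; last by rewrite addn0.
  rewrite big_nat big1 // => k /andP[nk _].
  by rewrite divn_small // (leq_trans nk) // ltnW // ltn_expl.
rewrite ext -big_split /=.
have -> : trunc_log q n.*2 = \sum_(1 <= k < n.*2.+1) (k <= trunc_log q n.*2).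
  set t := trunc_log _ _.
  have tn : t <= n.*2.
    apply: leq_trans (trunc_logP q1 n20); exact: ltnW (ltn_expl _ q1).
  rewrite (@big_cat_nat _ _ _ t.+1 1 n.*2.+1) //=.
  have -> : \sum_(t.+1 <= k < n.*2.+1) (k <= t) = 0.
    by rewrite big_nat big1 // => k /andP[tk _]; rewrite leqNgt tk.
  rewrite (eq_big_nat _ _ (F2 := fun=> 1)); last by move=> k /andP[_]; rewrite ltnS => ->.
  by rewrite sum_nat_const_nat subn1 muln1 addn0.
rewrite -big_split /=; apply: leq_sum => k _.
case: (leqP k (trunc_log q n.*2)) => kt.
  have qk0 : 0 < q ^ k by rewrite expn_gt0 ltnW.
  have h1 := ltn_ceil n qk0.
  rewrite -ltnS ltn_divLR // (_ : (true + _).+1 = (n %/ q ^ k).+1 * 2); last by rewrite /=; lia.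
  by rewrite mulnAC muln2 ltn_double.
rewrite divn_small //.
by rewrite ltnNge; apply: contraL kt => hk; rewrite -leqNgt trunc_log_max.
Qed.

(** The central binomial coefficient is at least 2^n and is a product of at most pi(2n) prime
    powers, each at most 2n. *)
Lemma chebyshev n : 0 < n -> 2 ^ n <= n.*2 ^ size (prime_list n.*2).
Proof.
move=> n0; apply: leq_trans (central_bin_ge n) _.
have c0 : 0 < 'C(n.*2, n) by rewrite bin_gt0 -addnn leq_addr.
rewrite [X in X <= _](prod_prime_decomp c0) prime_decompE big_map /=.
have sub : {subset primes 'C(n.*2, n) <= prime_list n.*2}.
  move=> q; rewrite mem_primes mem_prime_list => /and3P[qp _ qc]; rewrite qp /=.
  have := logn_central_bin qp n0; apply: leq_trans.
  rewrite -{1}(expn1 q) leq_exp2l ?prime_gt1 // logn_gt0 mem_primes qp c0 //.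
have us : size (primes 'C(n.*2, n)) <= size (prime_list n.*2).
  exact: uniq_leq_size (primes_uniq _) sub.
apply: (@leq_trans (\prod_(q <- primes 'C(n.*2, n)) n.*2)).
  rewrite big_seq [X in _ <= X]big_seq; apply: leq_prod => q.
  by rewrite mem_primes => /and3P[qp _ _]; apply: logn_central_bin.
by rewrite big_const_seq count_predT iter_muln_1 leq_pexp2l ?double_gt0.
Qed.

Lemma prime_list_exp2 j : 0 < j -> 2 ^ j.-1 <= j * size (prime_list (2 ^ j)).
Proof.
case: j => // j _ /=; have := @chebyshev (2 ^ j); rewrite expn_gt0 => /(_ isT).
by rewrite -mul2n -expnS -expnM leq_exp2l.
Qed.

Import Order.TTheory GRing.Theory Num.Theory.
Local Open Scope ring_scope.

(** * The cocycle of a period function *)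

(* Sum of P over the edges of a Farey path from e1 to the direction (m, k), where
   s and t are the values of a linear form at e1 and e2; f is the fuel. *)
Fixpoint farey (R : nmodType) (P : R -> R -> R) (f m k : nat) (s t : R) : R :=
  if f is f'.+1 then
    if k == 0%N then 0
    else if m == 0%N then P s t
    else if (k <= m)%N then farey P f' (m - k) k s (s + t)
    else P s (s + t) + farey P f' m (k - m) (s + t) t
  else 0.

HB.lock Definition psin (R : nmodType) (P : R -> R -> R) (m k : nat) (s t : R) : R :=
  farey P (m + k).+1 m k s t.

(** The first two equations give P(t, - s) = - P(s, t), so an edge cancels its reversal. The third,
    the Lewis equation, says that inserting the mediant e1 + e2 into the edge from e1 to e2 leaves
    the path sum unchanged. *)
Definition period_function (R : zmodType) (P : R -> R -> R) :=
  [/\ forall s t, P s (- t) = P s t,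
      forall s t, P t s = - P s t &
      forall s t, P s t = P (s + t) t + P s (s + t)].

Section Symbol.

Variables (R : numFieldType) (P : R -> R -> R).

Local Notation farey := (farey P).
Local Notation psin := (psin P).

(* For directions outside the first quadrant, reflect e2 to - e2. *)
Definition psi (m k : int) (s t : R) : R :=
  if 0 <= m * k then psin `|m| `|k| s t else psin `|m| `|k| s (- t).

Lemma farey_fuel f g m k s t :
  (m + k < f)%N -> (m + k < g)%N -> farey f m k s t = farey g m k s t.
Proof.
elim: f g m k s t => [|f IH] [|g] m k s t //= hf hg.
case: eqP => // k0; case: eqP => // m0; case: leqP => mk.
  by apply: IH; lia.
by congr (_ + _); apply: IH; lia.
Qed.

Lemma psin0r m s t : psin m 0 s t = 0.
Proof. by rewrite psin.unlock. Qed.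

Lemma psin0l k s t : (0 < k)%N -> psin 0 k s t = P s t.
Proof. by rewrite psin.unlock; case: k. Qed.

Lemma psin_ge m k s t : (0 < k)%N -> (k <= m)%N ->
  psin m k s t = psin (m - k) k s (s + t).
Proof.
move=> k0 km; rewrite {1}psin.unlock /=.
have -> : (k == 0%N) = false by lia.
have -> : (m == 0%N) = false by lia.
by rewrite km psin.unlock; apply: farey_fuel; lia.
Qed.

Lemma psin_lt m k s t : (0 < m)%N -> (m < k)%N ->
  psin m k s t = P s (s + t) + psin m (k - m) (s + t) t.
Proof.
move=> m0 mk; rewrite {1}psin.unlock /=.
have -> : (k == 0%N) = false by lia.
have -> : (m == 0%N) = false by lia.
by rewrite leqNgt mk /= psin.unlock; congr (_ + _); apply: farey_fuel; lia.
Qed.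

Lemma euclid_ind (Q : nat -> nat -> Prop) :
  (forall m, Q m 0%N) -> (forall k, (0 < k)%N -> Q 0%N k) ->
  (forall m k, (0 < k)%N -> (k <= m)%N -> Q (m - k)%N k -> Q m k) ->
  (forall m k, (0 < m)%N -> (m < k)%N -> Q m (k - m)%N -> Q m k) ->
  forall m k, Q m k.
Proof.
move=> H0 H1 H2 H3 m k.
have [n] := ubnP (m + k)%N; elim: n m k => // n IH m k hn.
case: (posnP k) => [->//|k0]; case: (posnP m) => [->|m0]; first exact: H1.
case: (leqP k m) => km; first by apply: H2 => //; apply: IH; lia.
by apply: H3 => //; apply: IH; lia.
Qed.

Lemma psin_scale j m k s t : (0 < j)%N -> psin (j * m) (j * k) s t = psin m k s t.
Proof.
move=> j0; move: m k s t; apply: euclid_ind => [m|k k0|m k k0 km IH|m k m0 mk IH] s t.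
- by rewrite muln0 psin0r psin0r.
- by rewrite muln0 psin0l ?muln_gt0 ?j0 // psin0l.
- rewrite psin_ge ?muln_gt0 ?j0 ?leq_mul2l ?km ?orbT // -mulnBr IH.
  by rewrite [RHS]psin_ge.
- rewrite psin_lt ?muln_gt0 ?j0 ?ltn_pmul2l // -mulnBr IH.
  by rewrite [RHS]psin_lt.
Qed.

Hypothesis P_period : period_function P.

Let P_evenr s t : P s (- t) = P s t. Proof. by case: P_period. Qed.

Let P_anti s t : P t s = - P s t. Proof. by case: P_period. Qed.

Let P_lewis s t : P s t = P (s + t) t + P s (s + t). Proof. by case: P_period. Qed.

Let P_evenl s t : P (- s) t = P s t.
Proof. by rewrite P_anti P_evenr [RHS]P_anti. Qed.

Lemma psin_even m k s t : psin m k (- s) (- t) = psin m k s t.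
Proof.
move: m k s t; apply: euclid_ind => [m|k k0|m k k0 km IH|m k m0 mk IH] s t.
- by rewrite psin0r psin0r.
- by rewrite psin0l // psin0l // P_evenl P_evenr.
- by rewrite psin_ge // [RHS]psin_ge // -opprD IH.
- by rewrite psin_lt // [RHS]psin_lt // -opprD IH P_evenl P_evenr.
Qed.

(** A path from e1 may start with the edge to e2 and continue from e2. Each Euclid step is matched
    with one on the other side, and the Lewis equation absorbs the difference. *)
Lemma psin_swap m k s t : (0 < m + k)%N -> psin m k s t = P s t + psin k m t s.
Proof.
move: m k s t; apply: euclid_ind => [m|k k0|m k k0 km IH|m k m0 mk IH] s t hmk.
- rewrite psin0r psin0l; last by lia.
  by rewrite (P_anti s t) addrN.
- by rewrite psin0r psin0l // addr0.
- rewrite psin_ge // IH; last by lia.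
  have [mk|mk] := ltnP k m.
    by rewrite (psin_lt t s k0 mk) (P_lewis s t) (P_anti t (s + t)) [t + s]addrC; ring.
  have -> : m = k by lia.
  rewrite subnn psin0r (psin_ge t s k0 (leqnn k)) subnn psin0l //.
  by rewrite (P_lewis s t) [t + s]addrC (P_anti t (s + t)) addr0; ring.
- rewrite psin_lt // IH; last by lia.
  by rewrite (psin_ge t s m0 (ltnW mk)) (P_lewis s t) [t + s]addrC; ring.
Qed.

Lemma psi0r (m : int) (s t : R) : psi m 0 s t = 0.
Proof. by rewrite /psi mulr0 psin0r. Qed.

Lemma psi01 s t : psi 0 1 s t = P s t.
Proof. by rewrite /psi mul0r psin0l. Qed.

Lemma psi_nat (m k : nat) s t : psi m%:Z k%:Z s t = psin m k s t.
Proof. by rewrite /psi. Qed.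

Lemma psi_negl (m k : nat) s t : psi (- m%:Z) k%:Z s t = psin m k s (- t).
Proof.
rewrite /psi abszN !absz_nat; case: ifP => // h.
have [->|m0] := posnP m; last first.
  have -> : k = 0%N by nia.
  by rewrite !psin0r.
by case: (posnP k) => [->|k0]; rewrite ?psin0r // !psin0l.
Qed.

Lemma psiN (m k : int) (s t : R) : psi (- m) (- k) s t = psi m k s t.
Proof. by rewrite /psi mulrNN !abszN. Qed.

Lemma psi_reflect (m k : int) (s t : R) : psi (- m) k s (- t) = psi m k s t.
Proof.
wlog k0 : m k / 0 <= k.
  move=> W; have [k0|k0] := lerP 0 k; first exact: W.
  by rewrite -psiN -[RHS]psiN W // oppr_ge0 ltW.
rewrite -(gez0_abs k0); have [m0|m0] := lerP 0 m.
  by rewrite -(gez0_abs m0) psi_negl psi_nat opprK.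
rewrite -[m]opprK -(gez0_abs (_ : 0 <= - m)) ?oppr_ge0 ?ltW //.
by rewrite opprK psi_negl psi_nat.
Qed.

Lemma psi_even (m k : int) (s t : R) : psi m k (- s) (- t) = psi m k s t.
Proof. by rewrite /psi; case: ifP; rewrite psin_even. Qed.

(** This is the passage to the basis (e1, e1 + e2). In most cases it is a single Euclid step; a
    second-quadrant direction that the shear brings into the first quadrant needs [psin_swap] and
    the Lewis equation. *)
Lemma psi_T (m k : int) (s t : R) : psi (m + k) k s t = psi m k s (s + t).
Proof.
suff H (m' : int) (k' : nat) s' t' :
    psi (m' + k'%:Z) k'%:Z s' t' = psi m' k'%:Z s' (s' + t').
  case: (intP k) => [|k'|k']; first by rewrite !psi0r.
    exact: H.
  by rewrite -psiN opprD opprK H -[RHS]psiN opprK.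
have [->|k0] := posnP k'; first by rewrite !psi0r.
have [m0|m0] := lerP 0 m'.
  rewrite -(gez0_abs m0) -PoszD !psi_nat psin_ge ?leq_addl //.
  by rewrite addnK.
have -> : m' = - (`|m'|%N)%:Z by lia.
set x := `|m'|%N; have x0 : (0 < x)%N by rewrite /x; lia.
rewrite (psi_negl x); have [kx|kx] := leqP k' x.
  have -> : - x%:Z + k'%:Z = - (x - k')%N%:Z by lia.
  rewrite psi_negl (psin_ge _ _ k0 kx); congr (psin _ _ _ _); ring.
have -> : - x%:Z + k'%:Z = (k' - x)%N%:Z by lia.
rewrite psi_nat psin_lt; [|lia|lia].
have -> : (k' - (k' - x) = x)%N by lia.
rewrite [RHS]psin_lt // psin_swap; last by lia.
rewrite -(psin_even x (k' - x) t').
have -> : s' - (s' + t') = - t' by ring.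
by rewrite P_evenr (P_lewis s' t'); ring.
Qed.

Lemma psi_S (m k : int) (s t : R) : (m != 0) || (k != 0) ->
  psi m k s t = P s t + psi (- k) m t (- s).
Proof.
have H (m' k' : nat) s' t' : (0 < m' + k')%N ->
    psi m'%:Z k'%:Z s' t' = P s' t' + psi (- k'%:Z) m'%:Z t' (- s').
  by move=> hmk; rewrite psi_nat psi_negl opprK psin_swap.
wlog k0 : m k s t / 0 <= k.
  move=> W hmk; have [k0|k0] := lerP 0 k; first exact: W.
  by rewrite -psiN W ?oppr_eq0 //; [rewrite psiN|lia].
rewrite -(gez0_abs k0) => hmk; have [m0|m0] := lerP 0 m.
  by rewrite -(gez0_abs m0) H //; lia.
have -> : m = - (`|m|%N)%:Z by lia.
rewrite psi_negl psiN psi_nat psin_swap; last by lia.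
by rewrite P_evenr -psin_even opprK.
Qed.

Lemma psi_scale (j : nat) (m k : int) (s t : R) : (0 < j)%N ->
  psi (j%:Z * m) (j%:Z * k) s t = psi m k s t.
Proof.
move=> j0; rewrite /psi !abszM !absz_nat !psin_scale //.
have -> : (0 <= j%:Z * m * (j%:Z * k)) = (0 <= m * k); last by [].
have -> : j%:Z * m * (j%:Z * k) = (j * j)%N%:Z * (m * k) by rewrite PoszM; ring.
by rewrite pmulr_rge0 //; lia.
Qed.

Lemma psi_shift (j m k : int) (s t : R) : psi (m + j * k) k s t = psi m k s (j%:~R * s + t).
Proof.
have H (i : nat) m' s' t' : psi (m' + i%:Z * k) k s' t' = psi m' k s' (i%:R * s' + t').
  elim: i m' t' => [|i IH] m' t'; first by rewrite mul0r addr0 mul0r add0r.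
  have -> : m' + i.+1%:Z * k = (m' + i%:Z * k) + k by rewrite intS; ring.
  rewrite psi_T IH; congr (psi _ _ _ _); rewrite -[in RHS]natr1; ring.
have [j0|j0] := lerP 0 j; first by rewrite -(gez0_abs j0) H.
have -> : j = - (`|j|%N)%:Z by lia.
rewrite -[in RHS](_ : m + - (`|j|%N)%:Z * k + (`|j|%N)%:Z * k = m); last by ring.
rewrite H; congr (psi _ _ _ _); rewrite mulrNz; ring.
Qed.

(* By induction on |be|: the matrix is a word in the generators of SL2(Z) handled
   by [psi_shift] and [psi_S]. *)
Lemma psi_cocycle (al be ga de m k : int) (s t : R) :
  al * de - be * ga = 1 -> (m != 0) || (k != 0) ->
  psi (m * al + k * ga) (m * be + k * de) s t =
  psi al be s t + psi m k (al%:~R * s + be%:~R * t) (ga%:~R * s + de%:~R * t).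
Proof.
have [n] := ubnP `|be|%N; elim: n al be ga de m k s t => // n IH al be ga de m k s t hn hdet hmk.
have [be0|be0] := eqVneq be 0.
  move: hdet; rewrite be0 mul0r subr0 psi0r mulr0 add0r mul0r addr0 add0r => hdet.
  have /orP[/eqP al1|/eqP al1] : (al == 1) || (al == -1).
    have: (`|al| * `|de| = 1)%N by rewrite -abszM hdet.
    by move/eqP; rewrite muln_eq1 => /andP[/eqP h _]; lia.
    have de1 : de = 1 by move: hdet; rewrite al1 mul1r.
    by rewrite al1 de1 !mulr1 mul1r [k * ga]mulrC psi_shift mul1r.
  have de1 : de = -1 by lia.
  rewrite al1 de1 -psi_even -psiN.
  have -> : - (m * -1 + k * ga) = m + (- ga) * k by ring.
  have -> : - (k * -1) = k by ring.
  by rewrite psi_shift; congr (psi _ _ _ _); rewrite !mulrNz; ring.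
(* One shear by the quotient j and one rotation replace the first row (al, be) by (be, - r), and |r|
   < |be|. *)
have [hjr hr] : al = (al %/ be)%Z * be + (al %% be)%Z /\ 0 <= (al %% be)%Z < `|be|.
  by rewrite -divz_eq modz_ge0 ?ltz_mod.
set j := (al %/ be)%Z in hjr; set r := (al %% be)%Z in hjr hr.
set M := m * r + k * (ga - j * de); set K := m * be + k * de.
have -> : m * al + k * ga = M + j * K by rewrite /M /K hjr; ring.
have hMK : (M != 0) || (K != 0).
  rewrite -negb_and; apply/negP => /andP[/eqP M0 /eqP K0].
  have em : m = de * (M + j * K) - ga * K.
    by rewrite -[LHS]mulr1 -hdet /M /K hjr; ring.
  have ek : k = al * K - be * (M + j * K).
    by rewrite -[LHS]mulr1 -hdet /M /K hjr; ring.
  have m0 : m = 0 by rewrite em M0 K0; ring.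
  have k0 : k = 0 by rewrite ek M0 K0; ring.
  by move: hmk; rewrite m0 k0.
rewrite {1}hjr [_ * be + r]addrC !psi_shift.
rewrite psi_S // [psi r be _ _]psi_S ?be0 ?orbT // -addrA; congr (_ + _).
rewrite -psiN opprK -[psi (- be) r _ _]psiN opprK.
have -> : K = m * be + k * de by [].
have -> : - M = m * (- r) + k * (- (ga - j * de)) by rewrite /M; ring.
rewrite IH //; last 2 first.
- by lia.
- by rewrite -hdet hjr; ring.
congr (_ + psi _ _ _ _).
  by rewrite [in RHS]hjr !(rmorphD, rmorphM, rmorphN) /= ; ring.
by rewrite !(rmorphD, rmorphM, rmorphN) /=; ring.
Qed.

End Symbol.

(** * Hecke operators on the cocycle *)

(** Shear and rotation run Euclid's algorithm on (m, k) down to k = 0, so the two relations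
    determine U from its value Q at e2. *)
Lemma psi_unique (R : numFieldType) (Q : R -> R -> R) (U : int -> int -> R -> R -> R) :
  period_function Q ->
  (forall m s t, U m 0 s t = 0) ->
  (forall m k s t, U (m + k) k s t = U m k s (s + t)) ->
  (forall m k s t, (m != 0) || (k != 0) -> U m k s t = Q s t + U (- k) m t (- s)) ->
  forall m k s t, U m k s t = psi Q m k s t.
Proof.
move=> hQ U0 UT US m k s t.
have [n] := ubnP `|k|%N; elim: n m k s t => // n IH m k s t hn.
have [->|k0] := eqVneq k 0; first by rewrite U0 psi0r.
have shiftN (i : nat) m' s' t' : U (m' + i%:Z * k) k s' t' = U m' k s' (i%:R * s' + t').
  elim: i m' t' => [|i IHi] m' t'; first by rewrite mul0r addr0 mul0r add0r.
  have -> : m' + i.+1%:Z * k = (m' + i%:Z * k) + k by rewrite intS; ring.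
  rewrite UT IHi; congr (U _ _ _ _); rewrite -[in RHS]natr1; ring.
have shift (j m' : int) s' t' : U (m' + j * k) k s' t' = U m' k s' (j%:~R * s' + t').
  have [j0|j0] := lerP 0 j; first by rewrite -(gez0_abs j0) shiftN.
  have -> : j = - (`|j|%N)%:Z by lia.
  rewrite -[in RHS](_ : m' + - (`|j|%N)%:Z * k + (`|j|%N)%:Z * k = m'); last by ring.
  rewrite shiftN; congr (U _ _ _ _); rewrite mulrNz; ring.
rewrite (divz_eq m k) addrC shift psi_shift //.
rewrite US ?k0 ?orbT // psi_S ?k0 ?orbT // IH //.
by have := ltz_mod m k0; have := modz_ge0 m k0; lia.
Qed.

Section Hecke.

Variables (R : numFieldType) (P : R -> R -> R) (q : nat).
Hypothesis P_period : period_function P.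
Hypothesis q_prime : prime q.

(* Sum over the sublattices of index q, with bases (e1, q e2) and (q e1, e2 - b e1). *)
Definition hecke (m k : int) (s t : R) : R :=
  psi P (m * q%:Z) k s (q%:R * t) +
  \sum_(0 <= b < q) psi P (m + b%:Z * k) (q%:Z * k) (q%:R * s) (t - b%:R * s).

Lemma hecke0r m s t : hecke m 0 s t = 0.
Proof.
rewrite /hecke psi0r add0r big1 // => b _; by rewrite !mulr0 psi0r.
Qed.

(** The shear fixes the first sublattice and permutes the others cyclically, b going to b + 1; the
    terms at b = q and b = 0 agree. *)
Lemma hecke_T m k s t : hecke (m + k) k s t = hecke m k s (s + t).
Proof.
rewrite /hecke; congr (_ + _).
  by rewrite mulrDl [k * _]mulrC psi_shift // mulrDr.
pose h (b : nat) := psi P (m + b%:Z * k) (q%:Z * k) (q%:R * s) (s + t - b%:R * s).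
have hq : h q = h 0%N.
  rewrite /h; have -> : m + q%:Z * k = m + 1 * (q%:Z * k) by rewrite mul1r.
  by rewrite psi_shift //; congr psi; rewrite ?mul0r ?addr0 //; ring.
rewrite -[RHS]/(\sum_(0 <= b < q) h b).
transitivity (\sum_(0 <= b < q) h b.+1).
  apply: eq_bigr => b _; rewrite /h; congr (psi _ _ _ _ _).
    by rewrite intS; ring.
  by rewrite -natr1; ring.
have q0 : (0 < q)%N by apply: prime_gt0.
rewrite -(big_add1 _ _ 0 q.+1 predT h) big_nat_recr //= hq.
by rewrite [RHS]big_ltn // addrC.
Qed.

Lemma sum_Fp (F : nat -> R) :
  \sum_(0 <= b < q) F b = F 0%N + \sum_(x : 'F_q | x != 0) F x.
Proof.
have -> : \sum_(0 <= b < q) F b = \sum_(0 <= b < (Zp_trunc (pdiv q)).+2) F b.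
  by rewrite Fp_cast.
by rewrite big_mkord (bigD1 0).
Qed.

Lemma sum_Fp_opp_inv (F : nat -> R) :
  \sum_(x : 'F_q | x != 0) F x = \sum_(x : 'F_q | x != 0) F (- x^-1 : 'F_q).
Proof.
rewrite (reindex_inj (h := fun x : 'F_q => - x^-1)); last first.
  by move=> x y /oppr_inj/invr_inj.
by apply: eq_bigl => x; rewrite oppr_eq0 invr_eq0.
Qed.

(** The rotation exchanges the sublattices with bases (e1, q e2) and (q e1, e2) and sends the one of
    x != 0 to that of y = - 1 / x modulo q. Writing x y + 1 = g q, [psi_cocycle] for the unimodular
    matrix with rows (x, q) and (- g, - y) compares the last two. *)
Lemma hecke_S m k s t : (m != 0) || (k != 0) ->
  hecke m k s t = hecke 0 1 s t + hecke (- k) m t (- s).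
Proof.
move=> hmk; have q0 : (0 < q)%N by apply: prime_gt0.
rewrite /hecke !sum_Fp.
rewrite (sum_Fp_opp_inv (fun b : nat =>
  psi P (- k + b%:Z * m) (q%:Z * m) (q%:R * t) (- s - b%:R * t))).
have -> : \sum_(x : 'F_q | x != 0)
     psi P (m + (x : nat)%:Z * k) (q%:Z * k) (q%:R * s) (t - (x : nat)%:R * s) =
   \sum_(x : 'F_q | x != 0)
     psi P (0 + (x : nat)%:Z * 1) (q%:Z * 1) (q%:R * s) (t - (x : nat)%:R * s) +
   \sum_(x : 'F_q | x != 0)
     psi P (- k + (- x^-1 : 'F_q)%:Z * m) (q%:Z * m) (q%:R * t)
        (- s - (- x^-1 : 'F_q)%:R * t).
  rewrite -big_split /=; apply: eq_bigr => x x0.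
  set y : 'F_q := - x^-1.
  have hxy : ((q %| x * y + 1)%N).
    rewrite (dvdn_pcharf (pchar_Fp q_prime)) natrD natrM !natr_Zp.
    by rewrite /y mulrN mulfV // addNr.
  have [g hg] := dvdnP hxy.
  have hz : (x : nat)%:Z * (y : nat)%:Z + 1 = g%:Z * q%:Z by lia.
  have := @psi_cocycle R P P_period (x : nat)%:Z q%:Z (- g%:Z) (- (y : nat)%:Z)
     (- k + (y : nat)%:Z * m) (q%:Z * m) (q%:R * s) (t - (x : nat)%:R * s).
  have -> : (- k + (y : nat)%:Z * m) * (x : nat)%:Z + q%:Z * m * - g%:Z = - (m + (x : nat)%:Z * k).
    have -> : q%:Z * m * - g%:Z = - m * (g%:Z * q%:Z) by ring.
    by rewrite -hz; ring.
  have -> : (- k + (y : nat)%:Z * m) * q%:Z + q%:Z * m * - (y : nat)%:Z = - (q%:Z * k) by ring.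
  rewrite psiN => ->; last 2 first.
  - have -> : (x : nat)%:Z * - (y : nat)%:Z - q%:Z * - g%:Z =
       g%:Z * q%:Z - (x : nat)%:Z * (y : nat)%:Z by ring.
    by rewrite -hz; ring.
  - move: hmk; have [->|m0] := eqVneq m 0 => /= k0.
      by rewrite mulr0 addr0 oppr_eq0 k0.
    by rewrite mulf_neq0 ?orbT // eqz_nat -lt0n.
  have hzR : (x : nat)%:R * (y : nat)%:R + 1 = g%:R * q%:R :> R.
    by rewrite -!natrM natr1 -addn1 hg natrM.
  congr (_ + _); first by congr psi; ring.
  congr (psi _ _ _ _ _); rewrite ?mulrNz -?pmulrn; first by ring.
  have -> : - g%:R * (q%:R * s) = - (g%:R * q%:R) * s by ring.
  by rewrite -hzR; ring.
rewrite !mul0r !addr0 !mulr1 !subr0.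
have qz : q%:Z != 0 by rewrite eqz_nat -lt0n.
rewrite [psi P (m * q%:Z) k s _]psi_S //; last by rewrite mulf_eq0 (negPf qz) orbF.
rewrite [psi P m (q%:Z * k) _ t]psi_S //; last by rewrite mulf_eq0 (negPf qz).
have psi0q (s' t' : R) : psi P 0 q%:Z s' t' = P s' t'.
  by rewrite -[q%:Z]mulr1 -[0](mulr0 q%:Z) psi_scale // psi01.
by rewrite psi01 psi0q !mulNr mulrN [m * q%:Z]mulrC [k * q%:Z]mulrC; ring.
Qed.

Definition hecke_period (s t : R) := hecke 0 1 s t.

(** Reflection maps the sublattice of b to that of - b, hence the reindexing by q - b. *)
Lemma hecke_even m k s t : hecke (- m) k s (- t) = hecke m k s t.
Proof.
rewrite /hecke mulNr mulrN psi_reflect //; congr (_ + _).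
pose h (b : nat) := psi P (m + b%:Z * k) (q%:Z * k) (q%:R * s) (t - b%:R * s).
have hq : h q = h 0%N.
  rewrite /h; have -> : m + q%:Z * k = m + 1 * (q%:Z * k) by rewrite mul1r.
  by rewrite psi_shift //; congr psi; rewrite ?mul0r ?addr0 //; ring.
rewrite -[RHS]/(\sum_(0 <= b < q) h b).
transitivity (\sum_(0 <= b < q) h (q - b)%N).
  apply: eq_big_nat => b /andP[_ bq]; rewrite /h -[LHS]psi_reflect //.
  have -> : m + (q - b)%N%:Z * k = m - b%:Z * k + 1 * (q%:Z * k).
    by rewrite -subzn ?(ltnW bq) //; ring.
  rewrite psi_shift // natrB ?(ltnW bq) //.
  by congr (psi _ _ _ _ _); ring.
have q0 : (0 < q)%N by apply: prime_gt0.
rewrite big_nat_rev /= add0n.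
transitivity (\sum_(0 <= b < q) h b.+1).
  by apply: eq_big_nat => b /andP[_ bq]; congr h; lia.
rewrite -(big_add1 _ _ 0 q.+1 predT h) big_nat_recr //= hq.
by rewrite [RHS]big_ltn // addrC.
Qed.

(** Antisymmetry is the rotation relation at the direction (1, 0), where [hecke] vanishes; the Lewis
    equation is the rotation relation at (1, 1). *)
Lemma hecke_period_function : period_function hecke_period.
Proof.
have even s t : hecke_period s (- t) = hecke_period s t.
  by rewrite /hecke_period -[in LHS]oppr0 hecke_even.
have anti s t : hecke_period t s = - hecke_period s t.
  have := @hecke_S 1 0 s t isT.
  rewrite hecke0r oppr0 -!/(hecke_period _ _) even => /esym/eqP.
  by rewrite addrC addr_eq0 => /eqP.
split=> // s t.
have h1 : hecke 1 1 s t = hecke_period s (s + t) by rewrite -[X in hecke X](add0r 1) hecke_T.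
have h2 : hecke (- 1) 1 t (- s) = hecke_period t (s + t).
  by rewrite -(even t (s + t)) /hecke_period -[X in _ = hecke X _ _ _](addNr 1) hecke_T; congr hecke; ring.
have := @hecke_S 1 1 s t isT; rewrite h1 h2 -/(hecke_period s t) => ->.
by rewrite [hecke_period (s + t) t]anti; ring.
Qed.

Lemma heckeE m k s t : hecke m k s t = psi hecke_period m k s t.
Proof.
apply: psi_unique; [exact: hecke_period_function|exact: hecke0r|exact: hecke_T|].
exact: hecke_S.
Qed.

End Hecke.

(** * Period polynomials of degree 10 *)

Section Forms.

Variable R : realFieldType.
Implicit Types (f g P : R -> R -> R) (s t : R).

(** Homogeneous polynomials of degree 10 are encoded as combinations of tenth powers of linear
    forms, which span them in characteristic 0; closure under linear substitution is then
    immediate. *)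
Definition is_form f := exists l : seq (R * R * R),
  forall s t, f s t = \sum_(x <- l) x.1.1 * (x.1.2 * s + x.2 * t) ^+ 10.

Lemma is_form_ext f g : (forall s t, f s t = g s t) -> is_form f -> is_form g.
Proof. by move=> fg [l hl]; exists l => s t; rewrite -fg. Qed.

Lemma is_form0 : is_form (fun _ _ => 0).
Proof. by exists [::] => s t; rewrite big_nil. Qed.

Lemma is_formD f g : is_form f -> is_form g -> is_form (fun s t => f s t + g s t).
Proof.
by move=> [l hl] [l' hl']; exists (l ++ l') => s t; rewrite big_cat hl hl'.
Qed.

Lemma is_form_sum (I : Type) (r : seq I) (F : I -> R -> R -> R) :
  (forall i, is_form (F i)) -> is_form (fun s t => \sum_(i <- r) F i s t).
Proof.
move=> hF; elim: r => [|i r IH].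
  by apply: is_form_ext is_form0 => s t; rewrite big_nil.
by apply: is_form_ext (is_formD (hF i) IH) => s t; rewrite big_cons.
Qed.

Lemma is_form_subst f a b c d :
  is_form f -> is_form (fun s t => f (a * s + b * t) (c * s + d * t)).
Proof.
move=> [l hl]; exists [seq (x.1.1, x.1.2 * a + x.2 * c, x.1.2 * b + x.2 * d) | x <- l] => s t.
rewrite hl big_map; apply: eq_bigr => x _ /=; congr (_ * _ ^+ _); ring.
Qed.

Lemma psin_is_form P m k : is_form P -> is_form (psin P m k).
Proof.
move=> hP; move: m k; apply: euclid_ind => [m|k k0|m k k0 km IH|m k m0 mk IH].
- by apply: is_form_ext is_form0 => s t; rewrite psin0r.
- by apply: is_form_ext hP => s t; rewrite psin0l.
- apply: is_form_ext (is_form_subst 1 0 1 1 IH) => s t.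
  by rewrite (psin_ge P s t k0 km) !mul1r mul0r addr0.
- apply: is_form_ext (is_formD (is_form_subst 1 0 1 1 hP) (is_form_subst 1 1 0 1 IH)) => s t.
  by rewrite (psin_lt P s t m0 mk) !mul1r !mul0r addr0 add0r.
Qed.

Lemma psi_is_form P m k : is_form P -> is_form (psi P m k).
Proof.
move=> hP; have [h|h] := boolP (0 <= m * k).
  by apply: is_form_ext (psin_is_form `|m| `|k| hP) => s t; rewrite /psi h.
apply: is_form_ext (is_form_subst 1 0 0 (-1) (psin_is_form `|m| `|k| hP)) => s t.
by rewrite /psi (negPf h) mul1r !mul0r addr0 add0r mulN1r.
Qed.

Lemma hecke_period_is_form P q : is_form P -> is_form (hecke_period P q).
Proof.
move=> hP; apply: is_formD.
  apply: is_form_ext (is_form_subst 1 0 0 q%:R (psi_is_form (0 * q%:Z) 1 hP)) => s t.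
  by rewrite mul1r !mul0r addr0 add0r.
apply: is_form_sum => b.
apply: is_form_ext (is_form_subst q%:R 0 (- b%:R) 1 (psi_is_form (0 + b%:Z * 1) (q%:Z * 1) hP)) => s t.
by rewrite mul1r !mul0r addr0 mulNr addrC [- _ + t]addrC.
Qed.

(** Averaging over t and - t keeps the even monomials; 45 and 210 are the binomial coefficients of
    10 over 2 and 4. *)
Lemma even_form f : is_form f -> (forall s t, f s (- t) = f s t) ->
  exists a0 a1 a2 a3 a4 a5 : R, forall s t,
    f s t = a0 * s ^+ 10 + a1 * (s ^+ 8 * t ^+ 2) + a2 * (s ^+ 6 * t ^+ 4) +
            a3 * (s ^+ 4 * t ^+ 6) + a4 * (s ^+ 2 * t ^+ 8) + a5 * t ^+ 10.
Proof.
move=> [l hl] hf.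
exists (\sum_(x <- l) x.1.1 * x.1.2 ^+ 10), (\sum_(x <- l) x.1.1 * (45%:R * x.1.2 ^+ 8 * x.2 ^+ 2)),
  (\sum_(x <- l) x.1.1 * (210%:R * x.1.2 ^+ 6 * x.2 ^+ 4)), (\sum_(x <- l) x.1.1 * (210%:R * x.1.2 ^+ 4 * x.2 ^+ 6)),
  (\sum_(x <- l) x.1.1 * (45%:R * x.1.2 ^+ 2 * x.2 ^+ 8)), (\sum_(x <- l) x.1.1 * x.2 ^+ 10) => s t.
have -> : f s t = (f s t + f s (- t)) / 2%:R by rewrite hf; field.
rewrite !hl -big_split /= !mulr_suml -!big_split /=; apply: eq_bigr => x _.
by field.
Qed.

(** This is s^2 t^2 (s^2 - t^2)^3, the even period polynomial of the discriminant form up to scaling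
    and a multiple of [eis_period]. *)
Definition cusp_period (s t : R) :=
  s ^+ 8 * t ^+ 2 - 3%:R * (s ^+ 6 * t ^+ 4) + 3%:R * (s ^+ 4 * t ^+ 6) - s ^+ 2 * t ^+ 8.

Definition eis_period (s t : R) := s ^+ 10 - t ^+ 10.

Lemma cusp_period_function : period_function cusp_period.
Proof. by split=> s t; rewrite /cusp_period; ring. Qed.

Lemma cusp_period_is_form : is_form cusp_period.
Proof.
(* The weights of s^10, t^10 and (s +- k t)^10, k <= 4, solve a 6 x 6 linear system. *)
exists [:: (- (14%:R * 1000%:R + 221%:R) / (720%:R * 504%:R), 1, 0); ((6%:R * 1000%:R + 107%:R) / 210%:R, 0, 1);
  (301%:R / (120%:R * 108%:R), 1, 1); (301%:R / (120%:R * 108%:R), 1, -1);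
  (- 757%:R / (360%:R * 504%:R), 1, 2%:R); (- 757%:R / (360%:R * 504%:R), 1, - 2%:R);
  (53%:R / (180%:R * 504%:R), 1, 3%:R); (53%:R / (180%:R * 504%:R), 1, - 3%:R);
  (- 31%:R / (1440%:R * 504%:R), 1, 4%:R); (- 31%:R / (1440%:R * 504%:R), 1, - 4%:R)] => s t.
by rewrite !big_cons big_nil /cusp_period /=; field.
Qed.

(** Antisymmetry at four points leaves a0, a1, a2 free among the six coefficients, and the Lewis
    equation at (2, 1) forces a2 = - 3 a1. *)
Lemma period_form_span f : is_form f -> period_function f ->
  exists x y, forall s t, f s t = x * cusp_period s t + y * eis_period s t.
Proof.
move=> hf [even anti lewis].
have [a0 [a1 [a2 [a3 [a4 [a5 fE]]]]]] := even_form hf even.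
have e1 := anti 1 0; have e2 := anti 1 2%:R; have e3 := anti 1 3%:R; have e4 := anti 1 1.
have e5 := lewis 2%:R 1.
rewrite !fE in e1 e2 e3 e4 e5.
have h0 : a5 = - a0 by move: e1; rewrite !expr0n !expr1n /= !(mulr0, mul0r, addr0, add0r, mulr1).
have h1 : a4 = - a1 by lra.
have h2 : a3 = - a2 by lra.
have h3 : a2 = - 3%:R * a1 by lra.
exists a1, a0 => s t; rewrite fE h0 h1 h2 h3 /cusp_period /eis_period; ring.
Qed.

End Forms.

(** * Sums of the cocycle over the directions (b, a) *)

Lemma big_nat_mul (V : nmodType) (q a : nat) (F : nat -> V) :
  \sum_(0 <= e < q * a) F e = \sum_(0 <= c < q) \sum_(0 <= b < a) F (b + c * a)%N.
Proof.
elim: q => [|q IH]; first by rewrite mul0n !big_geq.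
rewrite big_nat_recr //= -IH mulSn addnC.
rewrite (big_cat_nat (leq0n (q * a)) (leq_addr _ _)) /=; congr (_ + _).
by rewrite -{1}[(q * a)%N]add0n big_addn addKn.
Qed.

Lemma big_nat_coprime (V : nmodType) (q a : nat) (F : nat -> V) :
  coprime q a -> (forall j, F (j %% a)%N = F j) ->
  \sum_(0 <= b < a) F (b * q)%N = \sum_(0 <= b < a) F b.
Proof.
move=> cqa hF; case: a cqa hF => [|a] cqa hF; first by rewrite !big_geq.
rewrite !big_mkord.
pose h (i : 'I_a.+1) : 'I_a.+1 := inord ((i * q) %% a.+1).
have hE (i : 'I_a.+1) : h i = ((i * q) %% a.+1)%N :> nat by rewrite inordK ?ltn_mod.
rewrite [RHS](reindex_inj (h := h)); last first.
  have hinj (i j : 'I_a.+1) : (i <= j)%N -> h i = h j -> i = j.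
    move=> ij /(congr1 val) /=; rewrite !hE => /eqP.
    rewrite eq_sym eqn_mod_dvd ?leq_mul2r ?ij ?orbT // -mulnBl Gauss_dvdl 1?coprime_sym //.
    have := ltn_ord j => hj /dvdnP[[|k] hk]; apply: val_inj => /=; first by lia.
    by move: hk; rewrite mulSn; lia.
  move=> i j hij; have [ij|ij] := leqP i j; first exact: hinj.
  by apply/esym/hinj => //; apply: ltnW.
by apply: eq_bigr => i _; rewrite hE hF.
Qed.

Section PsiAlgebra.

Variable R : realFieldType.
Implicit Types (P : R -> R -> R) (s t : R).

Lemma eq_psi P P' m k s t : (forall s t, P s t = P' s t) -> psi P m k s t = psi P' m k s t.
Proof.
move=> PP'; have H (m' k' : nat) s' t' : psin P m' k' s' t' = psin P' m' k' s' t'.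
  move: m' k' s' t'; apply: euclid_ind => [m'|k' k0|m' k' k0 km IH|m' k' m0 mk IH] s' t'.
  - by rewrite !psin0r.
  - by rewrite !psin0l.
  - by rewrite (psin_ge P s' t' k0 km) IH (psin_ge P' s' t' k0 km).
  - by rewrite (psin_lt P s' t' m0 mk) IH (psin_lt P' s' t' m0 mk) PP'.
by rewrite /psi; case: ifP.
Qed.

Lemma psi_lin P P' (x y : R) m k s t :
  psi (fun s t => x * P s t + y * P' s t) m k s t = x * psi P m k s t + y * psi P' m k s t.
Proof.
set Q := fun s t => _.
have H (m' k' : nat) s' t' : psin Q m' k' s' t' = x * psin P m' k' s' t' + y * psin P' m' k' s' t'.
  move: m' k' s' t'; apply: euclid_ind => [m'|k' k0|m' k' k0 km IH|m' k' m0 mk IH] s' t'.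
  - by rewrite !psin0r !mulr0 addr0.
  - by rewrite !psin0l.
  - by rewrite (psin_ge Q s' t' k0 km) IH (psin_ge P s' t' k0 km) (psin_ge P' s' t' k0 km).
  - rewrite (psin_lt Q s' t' m0 mk) IH (psin_lt P s' t' m0 mk) (psin_lt P' s' t' m0 mk) /Q; ring.
by rewrite /psi; case: ifP.
Qed.

Lemma psi_hom P d c m k s t : (forall s t, P (c * s) (c * t) = c ^+ d * P s t) ->
  psi P m k (c * s) (c * t) = c ^+ d * psi P m k s t.
Proof.
move=> hP; have H (m' k' : nat) s' t' : psin P m' k' (c * s') (c * t') = c ^+ d * psin P m' k' s' t'.
  move: m' k' s' t'; apply: euclid_ind => [m'|k' k0|m' k' k0 km IH|m' k' m0 mk IH] s' t'.
  - by rewrite !psin0r mulr0.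
  - by rewrite !psin0l.
  - by rewrite (psin_ge P _ _ k0 km) -mulrDr IH (psin_ge P s' t' k0 km).
  - by rewrite (psin_lt P _ _ m0 mk) -mulrDr IH (psin_lt P s' t' m0 mk) hP mulrDr.
by rewrite /psi -mulrN; case: ifP.
Qed.

(** [eis_period] is a coboundary, so the path sum telescopes to s^10 minus the tenth power of the
    linear form at the end of the path, where the form vanishes. *)
Lemma psin_eis m k s t : (0 < k)%N -> m%:R * s + k%:R * t = 0 ->
  psin (@eis_period R) m k s t = s ^+ 10.
Proof.
move: m k s t; apply: euclid_ind => [m|k k0|m k k0 km IH|m k m0 mk IH] s t // hk e.
- rewrite psin0l // /eis_period; move/eqP: e; rewrite mul0r add0r mulf_eq0 pnatr_eq0.
  by rewrite -[k == 0%N]negbK -lt0n k0 /= => /eqP->; rewrite expr0n subr0.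
- rewrite psin_ge // IH // -e natrB //; ring.
- rewrite psin_lt // IH ?subn_gt0 //; first by rewrite /eis_period; ring.
  by rewrite -e natrB 1?ltnW //; ring.
Qed.

(* The linear form with values a and - b at e1 and e2 vanishes at (b, a). *)
Definition wsum P (a : nat) : R := \sum_(0 <= b < a) psi P b%:Z a%:Z a%:R (- b%:R).

Lemma wsum_eis a : (0 < a)%N -> wsum (@eis_period R) a = a%:R ^+ 11.
Proof.
move=> a0; rewrite /wsum (eq_bigr (fun=> a%:R ^+ 10)).
  by rewrite sumr_const_nat subn0 -[LHS]mulr_natr -exprSr.
by move=> b _; rewrite psi_nat psin_eis //; ring.
Qed.

Lemma wsum_lin P P' Q (x y : R) a : (forall s t, Q s t = x * P s t + y * P' s t) ->
  wsum Q a = x * wsum P a + y * wsum P' a.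
Proof.
move=> hQ; rewrite /wsum !mulr_sumr -big_split; apply: eq_bigr => b _ /=.
by rewrite -psi_lin; apply: eq_psi.
Qed.

(** The sublattices indexed by c contribute the residues b + c a modulo q a, that is
    [wsum P (q * a)]. The remaining one contributes the residues b q modulo a: a permutation if q
    does not divide a, and otherwise q copies of the residues modulo a / q, each with a factor q^10
    by homogeneity. *)
Lemma wsum_hecke P q a : period_function P -> prime q -> (0 < a)%N ->
  (forall c s t, P (c * s) (c * t) = c ^+ 10 * P s t) ->
  wsum P (q * a) + (if (q %| a)%N then q%:R ^+ 11 * wsum P (a %/ q) else wsum P a) =
  wsum (hecke_period P q) a.
Proof.
move=> hP qp a0 hom; have q0 := prime_gt0 qp.
pose F (a j : nat) := psi P j%:Z a%:Z a%:R (- j%:R).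
have F_mod a' j : F a' (j %% a')%N = F a' j.
  rewrite /F [in RHS](divn_eq j a') addnC PoszD PoszM psi_shift //; congr psi.
  by rewrite natrD natrM -pmulrn; ring.
transitivity (\sum_(0 <= b < a) hecke P q b%:Z a%:Z a%:R (- b%:R)); last first.
  by apply: eq_bigr => b _; rewrite heckeE.
rewrite big_split /= exchange_big /= addrC; congr (_ + _).
  rewrite /wsum big_nat_mul; apply: eq_bigr => c _; apply: eq_bigr => b _.
  by rewrite PoszD !PoszM !natrD !natrM; congr psi; ring.
case: ifPn => [/dvdnP[a' ea]|qa]; last first.
  rewrite -[LHS](@big_nat_coprime _ q a (F a)) //; last by rewrite prime_coprime.
  by apply: eq_bigr => b _; rewrite /F PoszM natrM; congr psi; ring.
have a'0 : (0 < a')%N by move: a0; rewrite ea muln_gt0 => /andP[].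
rewrite ea mulnK // {1}mulnC big_nat_mul.
transitivity (\sum_(0 <= c < q) q%:R ^+ 10 * wsum P a').
  by rewrite sumr_const_nat subn0 -[RHS]mulr_natr; ring.
apply: eq_bigr => c _; rewrite mulr_sumr; apply: eq_bigr => b _.
have -> : psi P b%:Z a'%:Z a'%:R (- b%:R) = F a' (b + c * a')%N.
  by rewrite -[RHS]F_mod addnC modnMDl F_mod.
rewrite /F -psi_hom // -(psi_scale _ _ _ _ _ q0).
by rewrite !PoszM !natrM; congr psi; ring.
Qed.

Lemma wsum_cusp_hecke q : prime q -> exists x y : R, forall a, (0 < a)%N ->
  wsum (@cusp_period R) (q * a) +
    (if (q %| a)%N then q%:R ^+ 11 * wsum (@cusp_period R) (a %/ q)
     else wsum (@cusp_period R) a) =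
  x * wsum (@cusp_period R) a + y * a%:R ^+ 11.
Proof.
move=> qp; have hP := cusp_period_function R.
have [x [y hxy]] := period_form_span (hecke_period_is_form q (cusp_period_is_form R))
  (hecke_period_function hP qp).
exists x, y => a a0; rewrite wsum_hecke //; last first.
  by move=> c s t; rewrite /cusp_period; ring.
by rewrite (wsum_lin _ hxy) wsum_eis.
Qed.

End PsiAlgebra.

(** * Divisor sums *)

Definition dsum (R : nmodType) (f : nat -> R) (n : nat) := \sum_(d <- divisors n) f d.

Section DivisorSums.

Variable R : realFieldType.
Implicit Types (f g w : nat -> R).

Lemma eq_dsum f g n : (0 < n)%N -> (forall d, (0 < d)%N -> (d %| n)%N -> f d = g d) -> dsum f n = dsum g n.
Proof.
move=> n0 fg; apply: eq_big_seq => d; rewrite -dvdn_divisors // => dn.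
by apply: fg => //; apply: dvdn_gt0 dn.
Qed.

Lemma dsum_inv f n : (0 < n)%N -> dsum (fun d => f (n %/ d)%N) n = dsum f n.
Proof.
move=> n0.
have invK d : (d %| n)%N -> (n %/ (n %/ d) = d)%N.
  move=> /dvdnP[k e]; have : (0 < k * d)%N by rewrite -e.
  by rewrite muln_gt0 => /andP[k0 d0]; rewrite e mulnK // mulKn.
rewrite /dsum -(big_map (fun d => n %/ d)%N predT f).
apply: perm_big; apply: uniq_perm; rewrite ?divisors_uniq //.
  rewrite map_inj_in_uniq ?divisors_uniq // => x y; rewrite -!dvdn_divisors // => xn yn e.
  by rewrite -(invK _ xn) e invK.
move=> d; rewrite -dvdn_divisors //; apply/mapP/idP => [[e]|dn].
  by rewrite -dvdn_divisors // => en ->; rewrite dvdn_div //.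
by exists (n %/ d)%N; rewrite ?invK // -dvdn_divisors // dvdn_div //.
Qed.

Lemma dsum_hecke w q c x y n : prime q -> (0 < n)%N ->
  (forall a, (0 < a)%N -> w (q * a)%N + (if (q %| a)%N then c * w (a %/ q)%N else w a) =
     x * w a + y * a%:R ^+ 11) ->
  dsum w (q * n) + (if (q %| n)%N then c * dsum w (n %/ q) else 0) =
  x * dsum w n + y * dsum (fun a => a%:R ^+ 11) n.
Proof.
move=> qp n0 hw; have q0 := prime_gt0 qp.
rewrite /dsum !mulr_sumr -big_split /=.
rewrite [RHS](eq_big_seq (fun a => w (q * a)%N + (if (q %| a)%N then c * w (a %/ q)%N else w a))); last first.
  move=> a; rewrite -dvdn_divisors // => an; rewrite hw //; exact: dvdn_gt0 an.
rewrite big_split /=.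
have -> : \sum_(a <- divisors n) (if (q %| a)%N then c * w (a %/ q)%N else w a) =
  \sum_(a <- divisors n | (q %| a)%N) c * w (a %/ q)%N + \sum_(a <- divisors n | ~~ (q %| a)%N) w a.
  rewrite (bigID (fun a => (q %| a)%N)) /=; congr (_ + _); apply: eq_bigr => a.
    by move=> ->.
  by move/negPf=> ->.
have -> : \sum_(d <- divisors (q * n)) w d =
  \sum_(a <- divisors n) w (q * a)%N + \sum_(a <- divisors n | ~~ (q %| a)%N) w a.
  rewrite -(big_map (muln q) predT w) -[X in _ = _ + X]big_filter -big_cat /=; apply: perm_big.
  have qn0 : (0 < q * n)%N by rewrite muln_gt0 q0.
  apply: uniq_perm; rewrite ?divisors_uniq //.
    rewrite cat_uniq filter_uniq ?divisors_uniq // andbT map_inj_in_uniq ?divisors_uniq /=; last first.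
      by move=> a b _ _ /eqP; rewrite eqn_pmul2l // => /eqP.
    apply/hasPn => d; rewrite mem_filter => /andP[qd _].
    by apply: contra qd => /mapP[e _ ->]; apply: dvdn_mulr.
  move=> d; rewrite mem_cat mem_filter -!dvdn_divisors //.
  have [/dvdnP[e ->]|qd] /= := boolP (q %| d)%N.
    rewrite orbF mulnC dvdn_pmul2l // mem_map; first by rewrite -dvdn_divisors.
    by move=> a b /eqP; rewrite eqn_pmul2l // => /eqP.
  rewrite Gauss_dvdr 1?coprime_sym ?prime_coprime //.
  case: (d %| n)%N; rewrite ?orbT // orbF; apply/esym/negbTE.
  by apply: contra qd => /mapP[e _ ->]; apply: dvdn_mulr.
rewrite -!addrA; congr (_ + _); rewrite addrC; congr (_ + _).
case: ifPn => [qn|qn]; last first.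
  rewrite big_seq_cond big1 // => a /andP[]; rewrite -dvdn_divisors // => an qa.
  by rewrite (dvdn_trans qa an) in qn.
have [m em] := dvdnP qn; rewrite em mulnK //.
have m0 : (0 < m)%N by move: n0; rewrite em muln_gt0 => /andP[].
rewrite -[RHS]big_filter.
rewrite -(big_map (fun d => d %/ q)%N predT (fun d => c * w d)); apply: perm_big.
apply: uniq_perm; rewrite ?divisors_uniq //.
  rewrite map_inj_in_uniq ?filter_uniq ?divisors_uniq // => a b.
  by rewrite !mem_filter => /andP[qa _] /andP[qb _] e; rewrite -(divnK qa) e divnK.
move=> d; rewrite -dvdn_divisors //; apply/idP/mapP => [dm|[e]].
  exists (d * q)%N; last by rewrite mulnK.
  by rewrite mem_filter dvdn_mull // -dvdn_divisors ?muln_gt0 ?m0 // dvdn_pmul2r.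
rewrite mem_filter -dvdn_divisors ?muln_gt0 ?m0 // => /andP[/dvdnP[f ->]].
by rewrite dvdn_pmul2r // => fm ->; rewrite mulnK.
Qed.

End DivisorSums.

(** * Skoruppa sums *)

(* The quadruples ((a, b), (c, d)) of positive integers with a d + b c = n. *)
HB.lock Definition quads (n : nat) : seq ((nat * nat) * (nat * nat)) :=
  let ps := [seq (a, b) | a <- iota 1 n, b <- iota 1 n] in
  [seq x <- [seq (x, y) | x <- ps, y <- ps]
     | (x.1.1 * x.2.2 + x.1.2 * x.2.1 == n)%N].

Lemma quads_uniq n : uniq (quads n).
Proof.
rewrite quads.unlock; apply: filter_uniq; apply: allpairs_uniq.
- by apply: allpairs_uniq; rewrite ?iota_uniq // => -[a b] [c d].
- by apply: allpairs_uniq; rewrite ?iota_uniq // => -[a b] [c d].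
- by move=> [a b] [c d].
Qed.

Lemma mem_quads n a b c d : (((a, b), (c, d)) \in quads n) =
  [&& (0 < a)%N, (0 < b)%N, (0 < c)%N, (0 < d)%N & (a * d + b * c == n)%N].
Proof.
rewrite quads.unlock mem_filter /=; apply/andP/and5P => [[/eqP e]|[a0 b0 c0 d0 /eqP e]].
  case/allpairsP=> -[[a' b'] [c' d']] /= [/allpairsP[[? ?] /= [ha hb [? ?]]] /allpairsP[[? ?] /= [hc hd [? ?]]] [? ? ? ?]].
  by subst; move: ha hb hc hd; rewrite !mem_iota; split; lia.
split; first by apply/eqP.
by apply: allpairs_f; apply: allpairs_f; rewrite mem_iota; nia.
Qed.

Lemma big_seq_bij (V : nmodType) (T T' : eqType) (s : seq T) (s' : seq T')
    (h : T -> T') (g : T' -> T) (F : T' -> V) :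
  uniq s -> uniq s' ->
  (forall x, x \in s -> h x \in s' /\ g (h x) = x) ->
  (forall y, y \in s' -> g y \in s /\ h (g y) = y) ->
  \sum_(x <- s) F (h x) = \sum_(y <- s') F y.
Proof.
move=> us us' hh hg; rewrite -(big_map h predT F); apply: perm_big.
apply: uniq_perm => //.
  rewrite map_inj_in_uniq // => x y xs ys e.
  by have [_ <-] := hh _ xs; have [_ <-] := hh _ ys; rewrite e.
move=> y; apply/mapP/idP => [[x xs ->]|ys]; first by have [] := hh _ xs.
by have [gs e] := hg _ ys; exists (g y).
Qed.

Section Skoruppa.

Variable R : realFieldType.
Variable n : nat.
Implicit Types (F G : nat -> nat -> R).

Local Notation Sum4 P F :=
  (\sum_(x <- quads n | P x.1.1 x.1.2 x.2.1 x.2.2) F x.1.1 x.1.2 x.2.1 x.2.2).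

(** The map (a, b, c, d) -> (a - b, b, c + d, d) preserves a d + b c and turns the condition b < a
    into d < c. *)
Lemma quads_chi (F : nat -> nat -> nat -> nat -> R) :
  \sum_(x <- quads n | (x.1.2 < x.1.1)%N) F (x.1.1 - x.1.2)%N x.1.2 (x.2.1 + x.2.2)%N x.2.2 =
  \sum_(x <- quads n | (x.2.2 < x.2.1)%N) F x.1.1 x.1.2 x.2.1 x.2.2.
Proof.
rewrite -big_filter -[RHS]big_filter.
pose h (x : (nat * nat) * (nat * nat)) := ((x.1.1 - x.1.2, x.1.2)%N, (x.2.1 + x.2.2, x.2.2)%N).
pose g (x : (nat * nat) * (nat * nat)) := ((x.1.1 + x.1.2, x.1.2)%N, (x.2.1 - x.2.2, x.2.2)%N).
apply: (@big_seq_bij R _ _ _ _ h g (fun x => F x.1.1 x.1.2 x.2.1 x.2.2));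
  [exact: filter_uniq (quads_uniq n)|exact: filter_uniq (quads_uniq n)| |].
  move=> [[a b] [c d]]; rewrite !mem_filter !mem_quads /= => /and5P[ab a0 b0 c0 /andP[d0 /eqP e]].
  split; last by rewrite /g /h /= subnK ?(ltnW ab) // addnK.
  apply/andP; split; first by lia.
  apply/and5P; split; rewrite ?subn_gt0 ?addn_gt0 ?c0 //.
  by rewrite -e mulnBl mulnDr; apply/eqP; have := leq_mul2r d b a; nia.
move=> [[a b] [c d]]; rewrite !mem_filter !mem_quads /= => /and5P[cd a0 b0 c0 /andP[d0 /eqP e]].
split; last by rewrite /g /h /= subnK ?(ltnW cd) // addnK.
apply/andP; split; first by lia.
apply/and5P; split; rewrite ?subn_gt0 ?addn_gt0 ?a0 //.
by rewrite -e mulnBr mulnDl; apply/eqP; nia.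
Qed.

Lemma quads_swap (P : nat -> nat -> nat -> nat -> bool) (F : nat -> nat -> nat -> nat -> R) :
  \sum_(x <- quads n | P x.1.2 x.1.1 x.2.2 x.2.1) F x.1.2 x.1.1 x.2.2 x.2.1 =
  \sum_(x <- quads n | P x.1.1 x.1.2 x.2.1 x.2.2) F x.1.1 x.1.2 x.2.1 x.2.2.
Proof.
pose h (x : (nat * nat) * (nat * nat)) := ((x.1.2, x.1.1), (x.2.2, x.2.1)).
rewrite -big_filter -[RHS]big_filter.
apply: (@big_seq_bij R _ _ _ _ h h (fun x => F x.1.1 x.1.2 x.2.1 x.2.2));
  [exact: filter_uniq (quads_uniq n)|exact: filter_uniq (quads_uniq n)| |].
  move=> [[a b] [c d]]; rewrite !mem_filter !mem_quads /= => /and5P[-> -> -> -> /andP[-> /eqP e]].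
  by rewrite addnC e eqxx.
move=> [[a b] [c d]]; rewrite !mem_filter !mem_quads /= => /and5P[-> -> -> -> /andP[-> /eqP e]].
by rewrite addnC e eqxx.
Qed.

Lemma quads_dual (P : nat -> nat -> nat -> nat -> bool) (F : nat -> nat -> nat -> nat -> R) :
  \sum_(x <- quads n | P x.2.2 x.2.1 x.1.2 x.1.1) F x.2.2 x.2.1 x.1.2 x.1.1 =
  \sum_(x <- quads n | P x.1.1 x.1.2 x.2.1 x.2.2) F x.1.1 x.1.2 x.2.1 x.2.2.
Proof.
pose h (x : (nat * nat) * (nat * nat)) := ((x.2.2, x.2.1), (x.1.2, x.1.1)).
rewrite -big_filter -[RHS]big_filter.
apply: (@big_seq_bij R _ _ _ _ h h (fun x => F x.1.1 x.1.2 x.2.1 x.2.2));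
  [exact: filter_uniq (quads_uniq n)|exact: filter_uniq (quads_uniq n)| |].
  move=> [[a b] [c d]]; rewrite !mem_filter !mem_quads /= => /and5P[-> -> -> -> /andP[-> /eqP e]].
  by rewrite mulnC [(c * b)%N]mulnC e eqxx.
move=> [[a b] [c d]]; rewrite !mem_filter !mem_quads /= => /and5P[-> -> -> -> /andP[-> /eqP e]].
by rewrite mulnC [(c * b)%N]mulnC e eqxx.
Qed.

(** For c = d the equation reads (a + b) c = n, so m = a + b runs over the divisors of n and a over
    1, ..., m - 1. *)
Lemma quads_diag_cd (F : nat -> nat -> nat -> R) : (0 < n)%N ->
  \sum_(x <- quads n | x.2.1 == x.2.2) F x.1.1 x.1.2 x.2.2 =
  dsum (fun m => \sum_(1 <= a < m) F a (m - a)%N (n %/ m)%N) n.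
Proof.
move=> n0; rewrite /dsum -big_filter.
pose s' := [seq (m, a) | m <- divisors n, a <- index_iota 1 m].
transitivity (\sum_(x <- s') F x.2 (x.1 - x.2)%N (n %/ x.1)%N); last by rewrite big_allpairs_dep.
have us' : uniq s'.
  apply: allpairs_uniq_dep => [|m _|]; rewrite ?divisors_uniq ?iota_uniq //.
  by move=> [m a] [m' a'] /= _ _ [-> ->].
have ms' m a : ((m, a) \in s') = [&& (m %| n)%N, (0 < a)%N & (a < m)%N].
  apply/allpairsPdep/and3P => [[m' [a' [hm ha [-> ->]]]]|[mn a0 am]].
    by move: hm ha; rewrite -dvdn_divisors // mem_index_iota => -> /andP[-> ->].
  by exists m, a; rewrite -dvdn_divisors // mem_index_iota a0 am.
pose h (x : (nat * nat) * (nat * nat)) := (x.1.1 + x.1.2, x.1.1)%N.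
pose g (x : nat * nat) := ((x.2, x.1 - x.2)%N, (n %/ x.1, n %/ x.1)%N).
rewrite -(big_seq_bij (s := [seq x <- quads n | x.2.1 == x.2.2]) (h := h) (g := g)) //.
- rewrite big_seq_cond [RHS]big_seq_cond; apply: eq_bigr => -[[a b] [c d]].
  rewrite mem_filter mem_quads /= => /andP[/and5P[/eqP-> a0 b0 c0 /andP[d0 /eqP e]] _].
  by rewrite addKn -e -mulnDl mulKn // addn_gt0 a0.
- exact: filter_uniq (quads_uniq n).
- move=> [[a b] [c d]]; rewrite mem_filter mem_quads /= => /and5P[/eqP-> a0 b0 c0 /andP[d0 /eqP e]].
  rewrite /h /= ms'; split; first by rewrite -e -mulnDl dvdn_mulr //= a0; lia.
  by rewrite /g /= addKn -{1 2}e -mulnDl mulKn // addn_gt0 a0.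
- move=> [m a]; rewrite ms' => /and3P[/dvdnP[k e] a0 am].
  have m0 : (0 < m)%N by apply: leq_trans am.
  have k0 : (0 < k)%N by move: n0; rewrite e muln_gt0 => /andP[].
  rewrite /h /g /= subnKC ?(ltnW am) //; split=> //.
  rewrite mem_filter mem_quads /= eqxx e mulnK // a0 subn_gt0 am k0 /=.
  by rewrite -mulnDl subnKC ?(ltnW am) // mulnC.
Qed.

Lemma quads_diag_ab (F : nat -> R) : (0 < n)%N ->
  \sum_(x <- quads n | x.1.1 == x.1.2) F x.1.1 =
  dsum (fun m => F m *+ (n %/ m).-1) n.
Proof.
move=> n0.
rewrite (quads_dual (fun a b c d => d == c) (fun a b c d => F d)).
under eq_bigl => x do rewrite eq_sym.
rewrite (quads_diag_cd (fun a b c => F c)) // -(dsum_inv (fun m => F m *+ (n %/ m).-1)) //.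
apply: eq_dsum => // m m0 /dvdnP[k e]; rewrite sumr_const_nat subn1.
have k0 : (0 < k)%N by move: n0; rewrite e muln_gt0 => /andP[].
by rewrite e mulnK // mulKn.
Qed.

(** Grouping by k = a d, the entry a divides k, b divides n - k = b c, and a and b determine the
    cofactors. *)
Lemma quads_conv (f g : nat -> R) : (0 < n)%N ->
  \sum_(x <- quads n) f x.1.1 * g x.1.2 = \sum_(1 <= k < n) dsum f k * dsum g (n - k)%N.
Proof.
move=> n0.
transitivity (\sum_(1 <= k < n) \sum_(x <- quads n | (x.1.1 * x.2.2 == k)%N) f x.1.1 * g x.1.2).
  rewrite (exchange_big_dep predT) //= big_seq [RHS]big_seq; apply: eq_bigr => -[[a b] [c d]] /=.
  rewrite mem_quads => /and5P[a0 b0 c0 d0 /eqP e].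
  under eq_bigl => k do rewrite eq_sym.
  rewrite -big_filter filter_pred1_uniq ?iota_uniq ?big_seq1 //.
  by rewrite mem_index_iota -e; nia.
apply: eq_big_nat => k /andP[k0 kn]; rewrite -big_filter.
rewrite /dsum mulr_suml; under [RHS]eq_bigr => a _ do rewrite mulr_sumr.
have nk0 : (0 < n - k)%N by rewrite subn_gt0.
pose s' := [seq (a, b) | a <- divisors k, b <- divisors (n - k)].
transitivity (\sum_(x <- s') f x.1 * g x.2); last by rewrite big_allpairs.
have us' : uniq s' by apply: allpairs_uniq; rewrite ?divisors_uniq // => -[a b] [c d].
have ms' a b : ((a, b) \in s') = (a %| k)%N && (b %| n - k)%N.
  apply/allpairsP/andP => [[[a' b'] /= [ha hb [-> ->]]]|[ha hb]].
    by rewrite !dvdn_divisors.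
  by exists (a, b); rewrite -!dvdn_divisors.
pose h (x : (nat * nat) * (nat * nat)) := x.1.
pose g' (x : nat * nat) := (x, ((n - k) %/ x.2, k %/ x.1)%N).
rewrite -(big_seq_bij (s := [seq x <- quads n | (x.1.1 * x.2.2 == k)%N]) (h := h) (g := g')) //.
- exact: filter_uniq (quads_uniq n).
- move=> [[a b] [c d]]; rewrite mem_filter mem_quads /= => /and5P[/eqP ek a0 b0 c0 /andP[d0 /eqP e]].
  have enk : (n - k = b * c)%N by rewrite -e ek addKn.
  rewrite /h /= ms' enk -ek !dvdn_mulr //; split=> //.
  by rewrite /g' /= enk -ek !mulKn.
- move=> [a b]; rewrite ms' => /andP[/dvdnP[x ex] /dvdnP[y ey]].
  split=> //; rewrite mem_filter mem_quads /=.
  have /andP[x0 a0] : (0 < x)%N && (0 < a)%N by rewrite -muln_gt0 -ex.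
  have /andP[y0 b0] : (0 < y)%N && (0 < b)%N by rewrite -muln_gt0 -ey.
  rewrite ey ex !mulnK // a0 b0 x0 y0 [(a * x)%N]mulnC -ex eqxx /=.
  by rewrite [(b * y)%N]mulnC -ey subnKC // ltnW.
Qed.

End Skoruppa.

(** * Kernels for the rearrangement and their power sums *)

Section PowerSums.

Variable R : realFieldType.
Implicit Types (m a : nat).

(* Symmetric solutions h of h(x, y) - h(x - y, y) = g(x, y) for g = x y^3 + x^3 y,
   x^3 y^3 and x y^5 + x^5 y. For [kernel_cusp] the right-hand side is
   691 cusp_period x (x - y) + 2400 (x^3 y^7 + x^7 y^3) - 10584 x^5 y^5, the last two
   terms being proportional to the convolutions in E4 E8 - E6^2. *)
Definition kernel13 (x y : R) : R :=
  (x ^+ 4 + y ^+ 4) / 4%:R + (x * y ^+ 3 + x ^+ 3 * y) / 2%:R + 3%:R / 4%:R * (x ^+ 2 * y ^+ 2).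
Definition kernel33 (x y : R) : R :=
  (x ^+ 2 * y ^+ 4 + x ^+ 4 * y ^+ 2) / 4%:R + x ^+ 3 * y ^+ 3 / 2%:R.
Definition kernel15 (x y : R) : R :=
  (x ^+ 6 + y ^+ 6) / 6%:R + (x * y ^+ 5 + x ^+ 5 * y) / 2%:R +
  5%:R / 12%:R * (x ^+ 2 * y ^+ 4 + x ^+ 4 * y ^+ 2).
Definition kernel_cusp (x y : R) : R :=
  991%:R * (x ^+ 2 * y ^+ 8 + x ^+ 8 * y ^+ 2) + 1200%:R * (x ^+ 3 * y ^+ 7 + x ^+ 7 * y ^+ 3)
  - 2437%:R * (x ^+ 4 * y ^+ 6 + x ^+ 6 * y ^+ 4) - 5292%:R * (x ^+ 5 * y ^+ 5).

(* In these power sums F is a discrete antiderivative of the summand. *)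
Lemma sum_kernel13 m : (0 < m)%N ->
  \sum_(1 <= a < m) kernel13 a%:R (m - a)%N%:R =
  (- (1%:R / 120%:R) * m%:R ^+ 1) + ((1%:R / 12%:R) * m%:R ^+ 3) + (- (1%:R / 4%:R) * m%:R ^+ 4) + ((7%:R / 40%:R) * m%:R ^+ 5) :> R.
Proof.
move=> m0; pose F (x : R) : R :=
  (- (1%:R / 120%:R) * x)
    + ((1%:R / 8%:R) * x * m%:R ^+ 2)
    + ((1%:R / 4%:R) * x * m%:R ^+ 3)
    + ((1%:R / 4%:R) * x * m%:R ^+ 4)
    + (- (1%:R / 8%:R) * x ^+ 2 * m%:R)
    + (- (3%:R / 8%:R) * x ^+ 2 * m%:R ^+ 2)
    + (- (1%:R / 4%:R) * x ^+ 2 * m%:R ^+ 3)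
    + ((1%:R / 12%:R) * x ^+ 3)
    + ((1%:R / 4%:R) * x ^+ 3 * m%:R)
    + ((1%:R / 4%:R) * x ^+ 3 * m%:R ^+ 2)
    + (- (1%:R / 8%:R) * x ^+ 4)
    + (- (1%:R / 8%:R) * x ^+ 4 * m%:R)
    + ((1%:R / 20%:R) * x ^+ 5).
rewrite (@telescope_sumr_eq _ 1 m (fun a => F a%:R)) //; first by rewrite /F; field.
move=> a /andP[_ am]; rewrite natrB; last exact: ltnW.
by rewrite -natr1 /kernel13 /F; field.
Qed.

Lemma sum_kernel33 m : (0 < m)%N ->
  \sum_(1 <= a < m) kernel33 a%:R (m - a)%N%:R =
  (- (1%:R / 120%:R) * m%:R ^+ 3) + ((1%:R / 120%:R) * m%:R ^+ 7) :> R.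
Proof.
move=> m0; pose F (x : R) : R :=
  (- (1%:R / 120%:R) * x * m%:R ^+ 2)
    + ((1%:R / 24%:R) * x * m%:R ^+ 4)
    + (- (1%:R / 8%:R) * x ^+ 2 * m%:R ^+ 3)
    + (- (1%:R / 8%:R) * x ^+ 2 * m%:R ^+ 4)
    + ((1%:R / 12%:R) * x ^+ 3 * m%:R ^+ 2)
    + ((1%:R / 4%:R) * x ^+ 3 * m%:R ^+ 3)
    + ((1%:R / 12%:R) * x ^+ 3 * m%:R ^+ 4)
    + (- (1%:R / 8%:R) * x ^+ 4 * m%:R ^+ 2)
    + (- (1%:R / 8%:R) * x ^+ 4 * m%:R ^+ 3)
    + ((1%:R / 20%:R) * x ^+ 5 * m%:R ^+ 2).
rewrite (@telescope_sumr_eq _ 1 m (fun a => F a%:R)) //; first by rewrite /F; field.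
move=> a /andP[_ am]; rewrite natrB; last exact: ltnW.
by rewrite -natr1 /kernel33 /F; field.
Qed.

Lemma sum_kernel15 m : (0 < m)%N ->
  \sum_(1 <= a < m) kernel15 a%:R (m - a)%N%:R =
  ((1%:R / 252%:R) * m%:R ^+ 1) + ((1%:R / 12%:R) * m%:R ^+ 5) + (- (1%:R / 6%:R) * m%:R ^+ 6) + ((5%:R / 63%:R) * m%:R ^+ 7) :> R.
Proof.
move=> m0; pose F (x : R) : R :=
  ((1%:R / 252%:R) * x)
    + (- (1%:R / 72%:R) * x * m%:R ^+ 2)
    + ((5%:R / 72%:R) * x * m%:R ^+ 4)
    + ((1%:R / 4%:R) * x * m%:R ^+ 5)
    + ((1%:R / 6%:R) * x * m%:R ^+ 6)
    + ((1%:R / 24%:R) * x ^+ 2 * m%:R)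
    + (- (5%:R / 24%:R) * x ^+ 2 * m%:R ^+ 4)
    + (- (1%:R / 4%:R) * x ^+ 2 * m%:R ^+ 5)
    + (- (1%:R / 36%:R) * x ^+ 3)
    + ((5%:R / 36%:R) * x ^+ 3 * m%:R ^+ 2)
    + ((5%:R / 36%:R) * x ^+ 3 * m%:R ^+ 4)
    + (- (5%:R / 24%:R) * x ^+ 4 * m%:R)
    + (- (5%:R / 24%:R) * x ^+ 4 * m%:R ^+ 2)
    + ((1%:R / 12%:R) * x ^+ 5)
    + ((1%:R / 4%:R) * x ^+ 5 * m%:R)
    + ((1%:R / 12%:R) * x ^+ 5 * m%:R ^+ 2)
    + (- (1%:R / 12%:R) * x ^+ 6)
    + (- (1%:R / 12%:R) * x ^+ 6 * m%:R)
    + ((1%:R / 42%:R) * x ^+ 7).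
rewrite (@telescope_sumr_eq _ 1 m (fun a => F a%:R)) //; first by rewrite /F; field.
move=> a /andP[_ am]; rewrite natrB; last exact: ltnW.
by rewrite -natr1 /kernel15 /F; field.
Qed.

Lemma sum_kernel_cusp m : (0 < m)%N ->
  \sum_(1 <= a < m) kernel_cusp a%:R (m - a)%N%:R =
  (- (841%:R / 15%:R) * m%:R ^+ 3) + (((10%:R * 1000%:R + 483%:R) / 63%:R) * m%:R ^+ 5) + (- (1682%:R / 15%:R) * m%:R ^+ 7) + ((568%:R / 315%:R) * m%:R ^+ 11) :> R.
Proof.
move=> m0; pose F (x : R) : R :=
  (- (841%:R / 15%:R) * x * m%:R ^+ 2)
    + ((2473%:R / 7%:R) * x * m%:R ^+ 4)
    + (- ((5%:R * 1000%:R + 637%:R) / 10%:R) * x * m%:R ^+ 6)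
    + ((991%:R / 6%:R) * x * m%:R ^+ 8)
    + (- (1682%:R / 3%:R) * x ^+ 2 * m%:R ^+ 3)
    + (((10%:R * 1000%:R + 483%:R) / 6%:R) * x ^+ 2 * m%:R ^+ 5)
    + (- 1682%:R * x ^+ 2 * m%:R ^+ 7)
    + (- (991%:R / 2%:R) * x ^+ 2 * m%:R ^+ 8)
    + ((3364%:R / 9%:R) * x ^+ 3 * m%:R ^+ 2)
    + (- 2473%:R * x ^+ 3 * m%:R ^+ 4)
    + ((5%:R * 1000%:R + 637%:R) * x ^+ 3 * m%:R ^+ 6)
    + (3364%:R * x ^+ 3 * m%:R ^+ 7)
    + ((991%:R / 3%:R) * x ^+ 3 * m%:R ^+ 8)
    + (((5%:R * 1000%:R + 887%:R) / 3%:R) * x ^+ 4 * m%:R ^+ 3)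
    + (- ((52%:R * 1000%:R + 415%:R) / 6%:R) * x ^+ 4 * m%:R ^+ 5)
    + (- ((16%:R * 1000%:R + 911%:R) / 2%:R) * x ^+ 4 * m%:R ^+ 6)
    + (- 1682%:R * x ^+ 4 * m%:R ^+ 7)
    + (- ((11%:R * 1000%:R + 774%:R) / 15%:R) * x ^+ 5 * m%:R ^+ 2)
    + ((7%:R * 1000%:R + 419%:R) * x ^+ 5 * m%:R ^+ 4)
    + ((10%:R * 1000%:R + 483%:R) * x ^+ 5 * m%:R ^+ 5)
    + (((16%:R * 1000%:R + 911%:R) / 5%:R) * x ^+ 5 * m%:R ^+ 6)
    + (- ((11%:R * 1000%:R + 774%:R) / 3%:R) * x ^+ 6 * m%:R ^+ 3)
    + (- (7%:R * 1000%:R + 419%:R) * x ^+ 6 * m%:R ^+ 4)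
    + (- ((10%:R * 1000%:R + 483%:R) / 3%:R) * x ^+ 6 * m%:R ^+ 5)
    + ((3364%:R / 3%:R) * x ^+ 7 * m%:R ^+ 2)
    + (3364%:R * x ^+ 7 * m%:R ^+ 3)
    + (((14%:R * 1000%:R + 838%:R) / 7%:R) * x ^+ 7 * m%:R ^+ 4)
    + (- 841%:R * x ^+ 8 * m%:R ^+ 2)
    + (- 841%:R * x ^+ 8 * m%:R ^+ 3)
    + ((1682%:R / 9%:R) * x ^+ 9 * m%:R ^+ 2).
rewrite (@telescope_sumr_eq _ 1 m (fun a => F a%:R)) //; first by rewrite /F; field.
move=> a /andP[_ am]; rewrite natrB; last exact: ltnW.
by rewrite -natr1 /kernel_cusp /F; field.
Qed.

Lemma sum_cusp_period m : (0 < m)%N ->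
  \sum_(1 <= a < m) @cusp_period R m%:R a%:R =
  ((1%:R / 30%:R) * m%:R ^+ 3) + (- (19%:R / 126%:R) * m%:R ^+ 5) + ((1%:R / 15%:R) * m%:R ^+ 7) + ((16%:R / 315%:R) * m%:R ^+ 11) :> R.
Proof.
move=> m0; pose F (x : R) : R :=
  ((1%:R / 30%:R) * x * m%:R ^+ 2)
    + ((1%:R / 14%:R) * x * m%:R ^+ 4)
    + ((1%:R / 10%:R) * x * m%:R ^+ 6)
    + ((1%:R / 6%:R) * x * m%:R ^+ 8)
    + (- (1%:R / 2%:R) * x ^+ 2 * m%:R ^+ 8)
    + (- (2%:R / 9%:R) * x ^+ 3 * m%:R ^+ 2)
    + (- (1%:R / 2%:R) * x ^+ 3 * m%:R ^+ 4)
    + (- 1%:R * x ^+ 3 * m%:R ^+ 6)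
    + ((1%:R / 3%:R) * x ^+ 3 * m%:R ^+ 8)
    + ((3%:R / 2%:R) * x ^+ 4 * m%:R ^+ 6)
    + ((7%:R / 15%:R) * x ^+ 5 * m%:R ^+ 2)
    + ((3%:R / 2%:R) * x ^+ 5 * m%:R ^+ 4)
    + (- (3%:R / 5%:R) * x ^+ 5 * m%:R ^+ 6)
    + (- (3%:R / 2%:R) * x ^+ 6 * m%:R ^+ 4)
    + (- (2%:R / 3%:R) * x ^+ 7 * m%:R ^+ 2)
    + ((3%:R / 7%:R) * x ^+ 7 * m%:R ^+ 4)
    + ((1%:R / 2%:R) * x ^+ 8 * m%:R ^+ 2)
    + (- (1%:R / 9%:R) * x ^+ 9 * m%:R ^+ 2).
rewrite (@telescope_sumr_eq _ 1 m (fun a => F a%:R)) //; first by rewrite /F; field.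
by move=> a /andP[_ am]; rewrite -natr1 /cusp_period /F; field.
Qed.

End PowerSums.

(** * Convolution identities for divisor functions *)

Section Convolutions.

Variables (R : realFieldType) (n : nat).
Hypothesis n0 : (0 < n)%N.
Implicit Types (f g h : R -> R -> R).

Definition upper f : R := \sum_(x <- quads n | (x.1.2 < x.1.1)%N) f x.1.1%:R x.1.2%:R.

Let mulrn_codiv (u : nat -> R) :
  dsum (fun m => u m *+ (n %/ m).-1) n = dsum (fun m => u m * (n%:R / m%:R - 1)) n.
Proof.
apply: eq_dsum => // m m0 /dvdnP[k e]; have k0 : (0 < k)%N by move: n0; rewrite e muln_gt0 => /andP[].
have -> : (n %/ m)%N = k by rewrite e mulnK.
have -> : n%:R = k%:R * m%:R :> R by rewrite e natrM.
rewrite mulfK ?pnatr_eq0 -?lt0n // -[LHS]mulr_natr.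
by case: k k0 {e} => // k _; rewrite /= -natr1 addrK.
Qed.

(** Symmetry makes the two off-diagonal halves equal; for a = b = m there are n / m - 1 pairs (c, d)
    with c + d = n / m. *)
Lemma quads_split_diag f : (forall x y, f y x = f x y) ->
  \sum_(x <- quads n) f x.1.1%:R x.1.2%:R =
  2%:R * upper f + dsum (fun m => f m%:R m%:R * (n%:R / m%:R - 1)) n.
Proof.
move=> fC; rewrite (bigID (fun x => x.1.2 < x.1.1)%N) /= -/(upper f).
rewrite (bigID (fun x => x.1.1 == x.1.2)%N) /=.
have -> : \sum_(i <- quads n | ~~ (i.1.2 < i.1.1)%N && (i.1.1 == i.1.2)) f i.1.1%:R i.1.2%:R =
   dsum (fun m => f m%:R m%:R * (n%:R / m%:R - 1)) n.
  rewrite -mulrn_codiv -(quads_diag_ab (fun m => f m%:R m%:R)) //.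
  apply: eq_big => [x|x /andP[_ /eqP<-]] //.
  by rewrite -leqNgt; case: eqVneq => [->|]; rewrite ?leqnn ?andbF.
have -> : \sum_(i <- quads n | ~~ (i.1.2 < i.1.1)%N && (i.1.1 != i.1.2)) f i.1.1%:R i.1.2%:R = upper f.
  rewrite /upper -(quads_swap n (fun a b c d => b < a)%N (fun a b c d => f a%:R b%:R)).
  apply: eq_big => [x|x _]; last by rewrite fC.
  by rewrite -leqNgt ltn_neqAle andbC.
ring.
Qed.

(* Subtracting the smaller of the first two coordinates exchanges the order of
   the first pair with the order of the second pair. *)
Lemma upper_shift h : (forall x y, h y x = h x y) ->
  2%:R * upper h - 2%:R * upper (fun x y => h (x - y) y) =
  dsum (fun m => \sum_(1 <= a < m) h a%:R (m - a)%N%:R) n -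
  dsum (fun m => h m%:R m%:R * (n%:R / m%:R - 1)) n.
Proof.
move=> hC; have := quads_split_diag hC.
have chiE : \sum_(x <- quads n | (x.2.2 < x.2.1)%N) h x.1.1%:R x.1.2%:R = upper (fun x y => h (x - y) y).
  rewrite -(quads_chi n (fun a b c d => h a%:R b%:R)) /upper; apply: eq_bigr => x lt.
  by rewrite natrB // ltnW.
rewrite (bigID (fun x => x.2.2 < x.2.1)%N) /= chiE.
rewrite (bigID (fun x => x.2.1 == x.2.2)%N) /=.
have -> : \sum_(i <- quads n | ~~ (i.2.2 < i.2.1)%N && (i.2.1 == i.2.2)) h i.1.1%:R i.1.2%:R =
   dsum (fun m => \sum_(1 <= a < m) h a%:R (m - a)%N%:R) n.
  rewrite -(quads_diag_cd (fun a b c => h a%:R b%:R)) //.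
  apply: eq_bigl => x; rewrite -leqNgt; case: eqVneq => [->|]; by rewrite ?leqnn ?andbF.
have -> : \sum_(i <- quads n | ~~ (i.2.2 < i.2.1)%N && (i.2.1 != i.2.2)) h i.1.1%:R i.1.2%:R =
    upper (fun x y => h (x - y) y).
  rewrite -(quads_swap n (fun a b c d => ~~ (d < c)%N && (c != d)) (fun a b c d => h a%:R b%:R)).
  transitivity (\sum_(x <- quads n | (x.2.2 < x.2.1)%N) h x.1.1%:R x.1.2%:R).
    apply: eq_big => [x|x _]; last by rewrite hC.
    by rewrite -leqNgt ltn_neqAle andbC.
  exact: chiE.
by move=> e; lra.
Qed.

Lemma dsumD (u v : nat -> R) : dsum u n + dsum v n = dsum (fun m => u m + v m) n.
Proof. by rewrite /dsum big_split. Qed.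

Lemma dsumZ c (u : nat -> R) : c * dsum u n = dsum (fun m => c * u m) n.
Proof. by rewrite /dsum mulr_sumr. Qed.

Definition sigmaR k : R := dsum (fun m => m%:R ^+ k) n.

(** Since g(m, m) = h(m, m) - h(0, m), the diagonal terms of [quads_split_diag] and [upper_shift]
    leave only h(0, m). *)
Lemma quads_identity g h : (forall x y, g y x = g x y) -> (forall x y, h y x = h x y) ->
  (forall x y, g x y = h x y - h (x - y) y) ->
  \sum_(x <- quads n) g x.1.1%:R x.1.2%:R =
  dsum (fun m => \sum_(1 <= a < m) h a%:R (m - a)%N%:R - h 0 m%:R * (n%:R / m%:R - 1)) n.
Proof.
move=> gC hC gh; rewrite quads_split_diag //.
have -> : upper g = upper h - upper (fun x y => h (x - y) y).
  by rewrite /upper -sumrB; apply: eq_bigr.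
rewrite mulrBr upper_shift // addrAC -addrA.
rewrite -[- dsum _ _]mulN1r dsumZ !dsumD; apply: eq_dsum => // m m0 _.
by rewrite gh subrr; ring.
Qed.

End Convolutions.

Section Sigma.

Variable R : realFieldType.

Local Notation sigma n k := (sigmaR R n k).
Local Notation conv n k l := (\sum_(1 <= j < n) sigma j k * sigma (n - j) l).

Lemma quads_monomial n k l : (0 < n)%N ->
  \sum_(x <- quads n) (x.1.1%:R ^+ k * x.1.2%:R ^+ l : R) = conv n k l.
Proof. by move=> n0; rewrite (quads_conv (fun a => a%:R ^+ k) (fun a => a%:R ^+ l)). Qed.

Lemma convC n k l : conv n k l = conv n l k.
Proof.
rewrite big_nat_rev /=; apply: eq_big_nat => j /andP[j0 jn].
by rewrite mulrC add1n subSS; congr (sigma _ _ * sigma _ _); lia.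
Qed.

(** This is 3 D E4 = E2 E4 - E6 read on coefficients. The derivative term n sigma_3 arises as n / m
    times [kernel13] at (0, m), which is m^4 / 4. *)
Lemma conv13 n : (0 < n)%N ->
  2%:R * conv n 1 3 = (7%:R / 40%:R) * sigma n 5 + (- (n%:R / 4%:R)) * sigma n 3
    + (1 / 12%:R) * sigma n 3 + (- (1 / 120%:R)) * sigma n 1.
Proof.
move=> n0; pose g (x y : R) := x ^+ 1 * y ^+ 3 + x ^+ 3 * y ^+ 1.
have gC x y : g y x = g x y by rewrite /g; ring.
have hC x y : kernel13 y x = kernel13 x y :> R by rewrite /kernel13; ring.
have gh x y : g x y = kernel13 x y - kernel13 (x - y) y by rewrite /g /kernel13; field.
have := quads_identity n0 gC hC gh.
rewrite big_split /= !quads_monomial // (convC n 3) => e.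
rewrite mulr_natl mulr2n e !dsumZ !dsumD; apply: eq_dsum => // m m0 _.
rewrite sum_kernel13 // /kernel13; field; by rewrite pnatr_eq0 -lt0n.
Qed.

Lemma conv33 n : (0 < n)%N ->
  conv n 3 3 = (1 / 120%:R) * sigma n 7 + (- (1 / 120%:R)) * sigma n 3.
Proof.
move=> n0; pose g (x y : R) := x ^+ 3 * y ^+ 3.
have gC x y : g y x = g x y by rewrite /g; ring.
have hC x y : kernel33 y x = kernel33 x y :> R by rewrite /kernel33; ring.
have gh x y : g x y = kernel33 x y - kernel33 (x - y) y by rewrite /g /kernel33; field.
have := quads_identity n0 gC hC gh.
rewrite quads_monomial // => ->; rewrite !dsumZ !dsumD; apply: eq_dsum => // m m0 _.
rewrite sum_kernel33 // /kernel33; field; by rewrite pnatr_eq0 -lt0n.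
Qed.

Lemma conv15 n : (0 < n)%N ->
  2%:R * conv n 1 5 = (5%:R / 63%:R) * sigma n 7 + (- (n%:R / 6%:R)) * sigma n 5
    + (1 / 12%:R) * sigma n 5 + (1 / 252%:R) * sigma n 1.
Proof.
move=> n0; pose g (x y : R) := x ^+ 1 * y ^+ 5 + x ^+ 5 * y ^+ 1.
have gC x y : g y x = g x y by rewrite /g; ring.
have hC x y : kernel15 y x = kernel15 x y :> R by rewrite /kernel15; ring.
have gh x y : g x y = kernel15 x y - kernel15 (x - y) y by rewrite /g /kernel15; field.
have := quads_identity n0 gC hC gh.
rewrite big_split /= !quads_monomial // (convC n 5) => e.
rewrite mulr_natl mulr2n e !dsumZ !dsumD; apply: eq_dsum => // m m0 _.
rewrite sum_kernel15 // /kernel15; field; by rewrite pnatr_eq0 -lt0n.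
Qed.

(** The kernel relation writes 691 times the summand as a shift difference, evaluated by
    [upper_shift], minus g, whose symmetric sum consists of convolutions. *)
Lemma upper_cusp n : (0 < n)%N ->
  1382%:R * upper n (fun x y : R => cusp_period x (x - y)) =
  dsum (fun m => \sum_(1 <= a < m) kernel_cusp a%:R (m - a)%N%:R) n -
  4800%:R * conv n 3 7 + (24%:R * 441%:R) * conv n 5 5.
Proof.
move=> n0; pose g (x y : R) :=
  2400%:R * (x ^+ 3 * y ^+ 7) + 2400%:R * (x ^+ 7 * y ^+ 3) - (24%:R * 441%:R) * (x ^+ 5 * y ^+ 5).
have gC x y : g y x = g x y by rewrite /g; ring.
have hC x y : kernel_cusp y x = kernel_cusp x y :> R by rewrite /kernel_cusp; ring.
have RE x y : 691%:R * cusp_period x (x - y) = kernel_cusp x y - kernel_cusp (x - y) y - g x y.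
  by rewrite /g /kernel_cusp /cusp_period; ring.
have e1 := upper_shift n0 hC; have e2 := quads_split_diag n0 gC.
have e3 : \sum_(x <- quads n) g x.1.1%:R x.1.2%:R =
    4800%:R * conv n 3 7 - (24%:R * 441%:R) * conv n 5 5.
  rewrite sumrB big_split /= -!mulr_sumr !quads_monomial // (convC n 7); ring.
have e4 : 691%:R * upper n (fun x y : R => cusp_period x (x - y)) =
    upper n (@kernel_cusp R) - upper n (fun x y => kernel_cusp (x - y) y) - upper n g.
  by rewrite /upper mulr_sumr -!sumrB; apply: eq_bigr.
(* The diagonals agree because [cusp_period] at (m, 0) and [kernel_cusp] at (0, m) both vanish. *)
have e5 : dsum (fun m => g m%:R m%:R * (n%:R / m%:R - 1)) n =
          dsum (fun m => kernel_cusp m%:R m%:R * (n%:R / m%:R - 1)) n.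
  by apply: eq_dsum => // m m0 _; congr (_ * _); rewrite /g /kernel_cusp; ring.
lra.
Qed.

(** The sum of Psi(a, b) over all quadruples is split once by the order of (a, b) and once by that
    of (c, d). The Farey step of Psi and [quads_chi] identify the off-diagonal parts up to the terms
    of [upper], so the diagonal c = d is what remains; one more Farey step turns it into the divisor
    sum of [wsum]. *)
Lemma dsum_wsum_upper n : (0 < n)%N ->
  dsum (wsum (@cusp_period R)) n = upper n (fun x y : R => cusp_period x (x - y)) +
    dsum (fun m => \sum_(1 <= b < m) @cusp_period R m%:R b%:R) n.
Proof.
move=> n0; have hP := cusp_period_function R.
pose Psi (s t : nat) := psi (@cusp_period R) t s s%:R (- t%:R).
have Psi_lt s t : (0 < t)%N -> (t < s)%N ->
    Psi s t = cusp_period s%:R (s%:R - t%:R) + Psi (s - t)%N t.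
  by move=> t0 ts; rewrite /Psi !psi_nat psin_lt // natrB ?(ltnW ts).
have Psi_ge s t : (0 < s)%N -> (s <= t)%N -> Psi s t = Psi s (t - s)%N.
  by move=> t0 ts; rewrite /Psi !psi_nat psin_ge // natrB // opprB.
have Psi0 s : Psi s 0%N = 0.
  case: s => [|s]; first by rewrite /Psi psi0r.
  rewrite /Psi psi_nat psin0l // /cusp_period oppr0; ring.
have pos x : x \in quads n -> [&& (0 < x.1.1)%N, (0 < x.1.2)%N, (0 < x.2.1)%N & (0 < x.2.2)%N].
  by case: x => [[a b] [c d]]; rewrite mem_quads /= => /and5P[-> -> -> -> _].
have e1 : \sum_(x <- quads n | (x.1.2 < x.1.1)%N) Psi x.1.1 x.1.2 =
    upper n (fun x y : R => cusp_period x (x - y)) +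
    \sum_(x <- quads n | (x.2.2 < x.2.1)%N) Psi x.1.1 x.1.2.
  rewrite -(quads_chi n (fun a b c d => Psi a b)) /upper -big_split /=.
  rewrite big_seq_cond [RHS]big_seq_cond; apply: eq_bigr => x /andP[/pos/and4P[a0 b0 _ _] lt].
  exact: Psi_lt.
have e2 : \sum_(x <- quads n | ~~ (x.1.2 < x.1.1)%N && (x.1.1 != x.1.2)) Psi x.1.1 x.1.2 =
    \sum_(x <- quads n | ~~ (x.2.2 < x.2.1)%N && (x.2.1 != x.2.2)) Psi x.1.1 x.1.2.
  transitivity (\sum_(x <- quads n | (x.1.2 < x.1.1)%N) Psi x.1.2 (x.1.1 - x.1.2)%N).
    rewrite -(quads_swap n (fun a b c d => ~~ (b < a)%N && (a != b)) (fun a b c d => Psi a b)).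
    rewrite big_seq_cond [RHS]big_seq_cond; apply: eq_big => [x|x /andP[/pos/and4P[a0 b0 _ _] lt]].
      by congr (_ && _); rewrite -leqNgt ltn_neqAle andbC.
    by apply: Psi_ge => //; rewrite leqNgt; case/andP: lt.
  rewrite (quads_chi n (fun a b c d => Psi b a)).
  rewrite -(quads_swap n (fun a b c d => ~~ (d < c)%N && (c != d)) (fun a b c d => Psi a b)).
  by apply: eq_bigl => x; rewrite -leqNgt ltn_neqAle andbC.
have e3 : \sum_(x <- quads n | ~~ (x.1.2 < x.1.1)%N && (x.1.1 == x.1.2)) Psi x.1.1 x.1.2 = 0.
  rewrite big_seq_cond big1 // => x /andP[/pos/and4P[a0 b0 _ _] /andP[_ /eqP<-]].
  by rewrite Psi_ge // subnn.
have e4 : \sum_(x <- quads n | ~~ (x.2.2 < x.2.1)%N && (x.2.1 == x.2.2)) Psi x.1.1 x.1.2 =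
    dsum (fun m => \sum_(1 <= a < m) Psi a (m - a)%N) n.
  rewrite -(quads_diag_cd (fun a b c => Psi a b)) //.
  by apply: eq_bigl => x; rewrite -leqNgt; case: eqVneq => [->|]; rewrite ?leqnn ?andbF.
have e5 : dsum (wsum (@cusp_period R)) n =
    dsum (fun m => \sum_(1 <= b < m) @cusp_period R m%:R b%:R) n +
    dsum (fun m => \sum_(1 <= a < m) Psi a (m - a)%N) n.
  rewrite dsumD; apply: eq_dsum => // m m0 _.
  rewrite /wsum big_ltn // -/(Psi m 0%N) Psi0 add0r.
  rewrite [\sum_(1 <= b < m) cusp_period _ _]big_nat_rev [\sum_(1 <= a < m) Psi a _]big_nat_rev /=.
  rewrite -big_split /=; apply: eq_big_nat => b /andP[b0 bm].
  rewrite -/(Psi m b) Psi_lt // add1n subSS natrB ?(ltnW bm) //; congr (_ + Psi _ _); lia.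
have tot1 : \sum_(x <- quads n) Psi x.1.1 x.1.2 =
    upper n (fun x y : R => cusp_period x (x - y)) +
    \sum_(x <- quads n | (x.2.2 < x.2.1)%N) Psi x.1.1 x.1.2 +
    \sum_(x <- quads n | ~~ (x.2.2 < x.2.1)%N && (x.2.1 != x.2.2)) Psi x.1.1 x.1.2.
  rewrite (bigID (fun x => x.1.2 < x.1.1)%N) /= e1; congr (_ + _).
  by rewrite (bigID (fun x => x.1.1 == x.1.2)) /= e2 e3 add0r.
have tot2 : \sum_(x <- quads n) Psi x.1.1 x.1.2 =
    \sum_(x <- quads n | (x.2.2 < x.2.1)%N) Psi x.1.1 x.1.2 +
    (dsum (fun m => \sum_(1 <= a < m) Psi a (m - a)%N) n +
    \sum_(x <- quads n | ~~ (x.2.2 < x.2.1)%N && (x.2.1 != x.2.2)) Psi x.1.1 x.1.2).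
  rewrite (bigID (fun x => x.2.2 < x.2.1)%N) /=; congr (_ + _).
  by rewrite (bigID (fun x => x.2.1 == x.2.2)) /= e4.
by rewrite e5; lra.
Qed.

Lemma dsum_wsum_cusp n : (0 < n)%N ->
  1382%:R * dsum (wsum (@cusp_period R)) n =
  72%:R * sigma n 11 - 10%:R * sigma n 3 - 42%:R * sigma n 5 - 20%:R * sigma n 7
  - 4800%:R * conv n 3 7 + (24%:R * 441%:R) * conv n 5 5.
Proof.
move=> n0; rewrite dsum_wsum_upper // mulrDr upper_cusp //.
suff : dsum (fun m => \sum_(1 <= a < m) kernel_cusp a%:R (m - a)%N%:R) n +
    1382%:R * dsum (fun m => \sum_(1 <= b < m) @cusp_period R m%:R b%:R) n =
    72%:R * sigma n 11 + (- 10%:R) * sigma n 3 + (- 42%:R) * sigma n 5 + (- 20%:R) * sigma n 7.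
  by move=> e; lra.
rewrite !dsumZ !dsumD; apply: eq_dsum => // m m0 _.
by rewrite sum_kernel_cusp // sum_cusp_period //; field.
Qed.

End Sigma.

(** * Eisenstein series *)

Section Series.

Variable R : realFieldType.
Implicit Types p q : {poly R}.

Local Notation sigma n k := (sigmaR R n k).
Local Notation conv n k l := (\sum_(1 <= j < n) sigma j k * sigma (n - j) l).

(** A q-expansion cut at order N; identities of series become congruences modulo X^N with an
    explicit cofactor. *)
Definition eisenstein (N : nat) (c : R) (k : nat) : {poly R} :=
  \poly_(i < N) (if i == 0%N then 1 else c * sigma i k).

Lemma coef_eisenstein N c k i : (0 < i < N)%N -> (eisenstein N c k)`_i = c * sigma i k.
Proof. by case/andP => i0 iN; rewrite coef_poly iN -[i == 0%N]negbK -lt0n i0. Qed.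

Lemma coef0_eisenstein N c k : (0 < N)%N -> (eisenstein N c k)`_0 = 1.
Proof. by move=> N0; rewrite coef_poly N0. Qed.

Lemma coef_mul_eisenstein N c k d l i : (0 < i < N)%N ->
  (eisenstein N c k * eisenstein N d l)`_i =
  c * sigma i k + d * sigma i l + c * d * conv i k l.
Proof.
move=> /andP[i0 iN]; have N0 : (0 < N)%N by apply: leq_trans iN.
rewrite coefM -(big_mkord predT (fun j => (eisenstein N c k)`_j * (eisenstein N d l)`_(i - j))).
rewrite big_ltn // big_nat_recr //= subn0 subnn !coef0_eisenstein // !coef_eisenstein ?i0 //.
rewrite (eq_big_nat _ _ (F2 := fun j => c * d * (sigma j k * sigma (i - j) l))); last first.
  by move=> j /andP[j0 ji]; rewrite !coef_eisenstein; [ring|lia|lia].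
rewrite -mulr_sumr; ring.
Qed.

Lemma coef_XD p i : ('X * p^`())`_i = i%:R * p`_i.
Proof. by rewrite coefXM; case: i => [|i] /=; rewrite ?mul0r // coef_deriv mulr_natl. Qed.

Lemma congr_coef N p q : (forall i, (i < N)%N -> p`_i = q`_i) -> exists r, p = q + 'X^N * r.
Proof.
move=> pq; exists (drop_poly N (p - q)); apply/polyP => i.
rewrite coefD coefXnM coef_drop_poly; case: ltnP => iN; first by rewrite pq // addr0.
by rewrite subnK // coefB addrC subrK.
Qed.

Lemma coef_congr N p q r i : p = q + 'X^N * r -> (i < N)%N -> p`_i = q`_i.
Proof. by move=> -> iN; rewrite coefD coefXnM iN addr0. Qed.

Section Weight12.

Variable N : nat.
Hypothesis N0 : (0 < N)%N.

Local Notation E2 := (eisenstein N (- 24%:R) 1).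
Local Notation E4 := (eisenstein N 240%:R 3).
Local Notation E6 := (eisenstein N (- 504%:R) 5).
Local Notation E8 := (eisenstein N 480%:R 7).

Lemma E4_sqr : exists r, E4 * E4 = E8 + 'X^N * r.
Proof.
apply: congr_coef => i iN; have [->|i0] := posnP i.
  by rewrite coef0M !coef0_eisenstein // mulr1.
rewrite coef_mul_eisenstein ?coef_eisenstein ?i0 //.
have := conv33 R i0; lra.
Qed.

Lemma ramanujan_E4 : exists r, 3%:R * ('X * E4^`()) = E2 * E4 - E6 + 'X^N * r.
Proof.
apply: congr_coef => i iN; rewrite mulr_natl coefMn coef_XD -mulr_natl.
have [->|i0] := posnP i.
  by rewrite coefB coef0M !coef0_eisenstein //; ring.
rewrite coefB coef_mul_eisenstein ?coef_eisenstein ?i0 //.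
by have := conv13 R i0; lra.
Qed.

Lemma ramanujan_E6 : exists r, 2%:R * ('X * E6^`()) = E2 * E6 - E4 * E4 + 'X^N * r.
Proof.
have [r hr] := E4_sqr; rewrite hr.
suff [r' ->] : exists r', 2%:R * ('X * E6^`()) = E2 * E6 - E8 + 'X^N * r'.
  by exists (r' + r); ring.
apply: congr_coef => i iN; rewrite mulr_natl coefMn coef_XD -mulr_natl.
have [->|i0] := posnP i.
  by rewrite coefB coef0M !coef0_eisenstein //; ring.
rewrite coefB coef_mul_eisenstein ?coef_eisenstein ?i0 //.
by have := conv15 R i0; lra.
Qed.

(** It agrees with E4^3 - E6^2 modulo X^N, and E8 in place of E4^2 keeps its coefficients within
    convolutions of two divisor functions. *)
Definition eis_disc : {poly R} := E4 * E8 - E6 * E6.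

(** With D = X d/dX, D(E4^3) = E4^2 (E2 E4 - E6) and D(E6^2) = E6 (E2 E6 - E4^2); the terms E4^2 E6
    cancel in the difference. Error terms survive D because D(X^N) = N X^N. *)
Lemma disc_ode : exists r, 'X * eis_disc^`() = E2 * eis_disc + 'X^N * r.
Proof.
have [a ha] := E4_sqr; have [b hb] := ramanujan_E4; have [c hc] := ramanujan_E6.
have e8 : E8 = E4 * E4 - 'X^N * a by rewrite ha addrK.
have XD : 'X * ('X^N)^`() = N%:R * 'X^N :> {poly R}.
  by rewrite derivXn mulrnAr -exprS prednK // mulr_natl.
have e6 : 'X * (E6 * E6)^`() = E6 * (2%:R * ('X * E6^`())).
  by rewrite derivM; ring.
have e4 : 'X * (E4 * (E4 * E4))^`() = E4 * E4 * (3%:R * ('X * E4^`())).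
  by rewrite !derivM; ring.
rewrite /eis_disc e8.
exists (E4 * E4 * b - E6 * c - 'X * (E4^`() * a + E4 * a^`()) - N%:R * E4 * a + E2 * (E4 * a)).
have -> : E4 * (E4 * E4 - 'X^N * a) = E4 * (E4 * E4) - E4 * ('X^N * a) by ring.
rewrite !derivB !mulrBr e4 e6 hb hc.
have -> : 'X * (E4 * ('X^N * a))^`() =
    E4 * a * ('X * ('X^N)^`()) + 'X^N * ('X * (E4^`() * a + E4 * a^`())).
  by rewrite !derivM; ring.
rewrite XD; ring.
Qed.

End Weight12.

(** * The differential equation of the product defining tau *)

Definition tauR (n : nat) : R := (tau n)%:~R.

(** The truncation of k X^k / (1 - X^k), which is minus the logarithmic derivative of 1 - X^k with
    respect to X d/dX. *)
Definition lambert (N k : nat) : {poly R} :=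
  \poly_(i < N) (if (0 < i)%N && (k %| i)%N then k%:R else 0).

Lemma lambert_geom N k : (0 < k)%N -> exists r, lambert N k * (1 - 'X^k) = k%:R * 'X^k + 'X^N * r.
Proof.
move=> k0; apply: congr_coef => i iN.
rewrite [in RHS]mulr_natl coefMn coefXn mulrBr mulr1 coefB coefMXn !coef_poly iN.
case: (ltngtP i k) => [ik|ki|->]; last 1 first.
- by rewrite k0 dvdnn subnn /= if_same subr0.
- rewrite subr0 mul0rn; case: ifP => // /andP[i0 /(dvdn_leq i0)]; lia.
- rewrite mul0rn (leq_ltn_trans (leq_subr _ _) iN) subn_gt0 ki (ltn_trans k0 ki) /=.
  by rewrite dvdn_subl ?dvdnn ?(ltnW ki) // subrr.
Qed.

Definition disc_prod (M : nat) : {poly R} := 'X * \prod_(1 <= k < M.+1) (1 - 'X^k) ^+ 24.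

Lemma discR_map M : disc_prod M = map_poly intr (discriminant_trunc M).
Proof.
rewrite /disc_prod /discriminant_trunc rmorphM /= map_polyX rmorph_prod; congr (_ * _).
by apply: eq_bigr => k _; rewrite rmorphXn rmorphB /= rmorph1 map_polyXn.
Qed.

(** Logarithmic differentiation of the product: the factor X contributes 1 and the k-th factor - 24
    [lambert N k]. *)
Lemma discR_ode N M : exists r,
  'X * (disc_prod M)^`() = disc_prod M * (1 - 24%:R * \sum_(1 <= k < M.+1) lambert N k) + 'X^N * r.
Proof.
elim: M => [|M [r hr]].
  by exists 0; rewrite /disc_prod !big_geq // derivM derivX derivC; ring.
have -> : disc_prod M.+1 = disc_prod M * (1 - 'X^(M.+1)) ^+ 24.
  by rewrite /disc_prod big_nat_recr //= mulrA.
rewrite [\sum_(1 <= k < M.+2) _]big_nat_recr //=.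
set S := \sum_(1 <= k < M.+1) _ in hr *; set D := disc_prod M in hr *.
have [s hs] := @lambert_geom N M.+1 isT; set g := lambert N M.+1 in hs *.
have XD : 'X * (1 - 'X^(M.+1))^`() = - (g * (1 - 'X^(M.+1))) + 'X^N * s :> {poly R}.
  by rewrite hs derivB derivC derivXn -mulr_natl /= exprS; ring.
set f := 1 - 'X^(M.+1) in hs XD *.
exists (r * f ^+ 24 + 24%:R * D * f ^+ 23 * s).
have -> : 'X * (D * f ^+ 24)^`() = ('X * D^`()) * f ^+ 24 + 24%:R * D * f ^+ 23 * ('X * f^`()).
  by rewrite derivM deriv_exp -mulr_natl; ring.
rewrite hr XD; ring.
Qed.

(** As E has constant term 1, the coefficient of X^n gives (n - 1) p_n in terms of earlier
    coefficients. This determines p_n for n >= 2, and p_1 is prescribed. *)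
Lemma ode_unique N (E p q : {poly R}) :
  E`_0 = 1 -> p`_0 = 0 -> q`_0 = 0 -> p`_1 = q`_1 ->
  (exists r, 'X * p^`() = E * p + 'X^N * r) -> (exists r, 'X * q^`() = E * q + 'X^N * r) ->
  forall i, (i < N)%N -> p`_i = q`_i.
Proof.
move=> E0 p0 q0 pq1 [r hr] [s hs] i.
elim/ltn_ind: i => i IH iN.
case: i IH iN => [|[|i]] IH iN; rewrite ?p0 ?q0 //.
have := coef_congr hr iN; have := coef_congr hs iN.
have hC (u : {poly R}) : (E * u)`_i.+2 =
    u`_i.+2 + \sum_(j < i.+2) E`_j.+1 * u`_(i.+1 - j).
  by rewrite coefM big_ord_recl E0 mul1r.
rewrite !coef_XD !hC.
have -> : \sum_(j < i.+2) E`_j.+1 * p`_(i.+1 - j) = \sum_(j < i.+2) E`_j.+1 * q`_(i.+1 - j).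
  by apply: eq_bigr => j _; rewrite IH //; lia.
set S := \sum_(_ < _) _ => e1 e2.
have : i.+1%:R * (p`_i.+2 - q`_i.+2) = 0.
  rewrite -[i.+2%:R]natr1 in e1 e2.
  have -> : i.+1%:R * (p`_i.+2 - q`_i.+2) =
    (i.+1%:R + 1) * p`_i.+2 - (i.+1%:R + 1) * q`_i.+2 - p`_i.+2 + q`_i.+2 by ring.
  by rewrite e1 e2; ring.
by move/eqP; rewrite mulf_eq0 pnatr_eq0 /= subr_eq0 => /eqP.
Qed.

Lemma sigma_small k : sigma 1 k = 1.
Proof. by rewrite /sigmaR /dsum big_seq1 expr1n. Qed.

Lemma coef_sum_lambert N M i : (0 < i)%N -> (i < N)%N -> (i <= M)%N ->
  (\sum_(1 <= k < M.+1) lambert N k)`_i = sigma i 1.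
Proof.
move=> i0 iN iM; rewrite coef_sum.
rewrite (eq_bigr (fun k => if (k %| i)%N then k%:R else 0)); last first.
  by move=> k _; rewrite coef_poly iN i0.
rewrite -big_mkcond /= -big_filter /sigmaR /dsum.
rewrite [RHS](eq_bigr (fun k => k%:R)); last by move=> k _; rewrite expr1.
apply: perm_big; apply: uniq_perm; rewrite ?filter_uniq ?iota_uniq ?divisors_uniq // => d.
rewrite mem_filter -dvdn_divisors // mem_index_iota andb_idr // => di.
by rewrite (dvdn_gt0 i0 di) ltnS (leq_trans (dvdn_leq i0 di)).
Qed.

(** Summing the Lambert series gives sigma_1, so both sides solve the equation with E2 modulo
    X^(n+1). The coefficient of X in [eis_disc] is 240 + 480 + 2 * 504 = 1728. *)
Lemma tau_disc n : (0 < n)%N -> 1728%:R * tauR n = (eis_disc n.+1)`_n.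
Proof.
move=> n0; have N0 : (0 < n.+1)%N by [].
have [r hr] := discR_ode n.+1 n.
have [s hs] : exists s, 1 - 24%:R * \sum_(1 <= k < n.+1) lambert n.+1 k =
    eisenstein n.+1 (- 24%:R) 1 + 'X^(n.+1) * s.
  apply: congr_coef => i iN; rewrite coefB mulr_natl coefMn.
  have [->|i0] := posnP i.
    rewrite coef0_eisenstein // coef1 /= coef_sum big1 ?mul0rn ?subr0 // => k _.
    by rewrite coef_poly.
  rewrite coef_sum_lambert // coef_eisenstein ?i0 // coef1 -[i == 0%N]negbK -lt0n i0.
  by rewrite /= sub0r -[sigma i 1 *+ 24]mulr_natl mulNr.
have D1 : (disc_prod n)`_1 = 1.
  rewrite /disc_prod coefXM /=; elim: (n) => [|m IH]; first by rewrite big_geq // coef1.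
  rewrite big_nat_recr //= coef0M IH mul1r.
  have : ((1 - 'X^(m.+1) : {poly R}) ^+ 24)`_0 = (1 - 'X^(m.+1) : {poly R})`_0 ^+ 24.
    by rewrite -!horner_coef0 horner_exp.
  by move=> ->; rewrite coefB coef1 coefXn subr0 expr1n.
have tauE : tauR n = (disc_prod n)`_n by rewrite discR_map coef_map.
have N1 : (1 < n.+1)%N by [].
rewrite tauE mulr_natl -coefMn.
apply: (@ode_unique n.+1 (eisenstein n.+1 (- 24%:R) 1)) => //.
- by rewrite coef0_eisenstein.
- by rewrite coefMn /disc_prod coefXM mul0rn.
- by rewrite /eis_disc coefB !coef0M !coef0_eisenstein // subrr.
- rewrite coefMn D1 /eis_disc coefB !coef_mul_eisenstein // !sigma_small !big_geq //; ring.
- exists (1728%:R * (disc_prod n * s + r)).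
  rewrite derivMn mulrnAr hr hs -[LHS]mulr_natl -[disc_prod n *+ _]mulr_natl.
  by move: (_%:R : {poly R}) => c; ring.
- exact: disc_ode.
Qed.

Lemma tauR_conv n : (0 < n)%N ->
  1728%:R * tauR n = 240%:R * sigma n 3 + 480%:R * sigma n 7 + 1008%:R * sigma n 5
    + 240%:R * 480%:R * conv n 3 7 - 504%:R * 504%:R * conv n 5 5.
Proof.
by move=> n0; rewrite tau_disc // coefB !coef_mul_eisenstein ?n0 ?ltnSn //; ring.
Qed.

(** Dividing [tauR_conv] by 24 gives exactly the convolutions and lower divisor sums of
    [dsum_wsum_cusp], which cancel. *)
Lemma manin n : (0 < n)%N ->
  691%:R * dsum (wsum (@cusp_period R)) n = 36%:R * (sigma n 11 - tauR n).
Proof.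
by move=> n0; have := dsum_wsum_cusp R n0; have := tauR_conv n0; lra.
Qed.

End Series.

(** * Hecke relations for tau *)

Section HeckeTau.

Variable R : realFieldType.

Local Notation sigma n k := (sigmaR R n k).
Local Notation tauR := (tauR R).

Lemma sigma2 k : sigma 2 k = 1 + 2%:R ^+ k.
Proof. by rewrite /sigmaR /dsum (_ : divisors 2 = [:: 1; 2]%N) // !big_cons big_nil expr1n addr0. Qed.

Lemma sigma3 k : sigma 3 k = 1 + 3%:R ^+ k.
Proof. by rewrite /sigmaR /dsum (_ : divisors 3 = [:: 1; 3]%N) // !big_cons big_nil expr1n addr0. Qed.

Lemma sigma4 k : sigma 4 k = 1 + 2%:R ^+ k + 4%:R ^+ k.
Proof.
by rewrite /sigmaR /dsum (_ : divisors 4 = [:: 1; 2; 4]%N) // !big_cons big_nil expr1n addr0 addrA.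
Qed.

Lemma tauR1 : tauR 1 = 1.
Proof. by have := tauR_conv R (isT : 0 < 1)%N; rewrite !sigma_small !big_geq //; lra. Qed.

Lemma tauR2 : tauR 2 = - 24%:R.
Proof.
have := tauR_conv R (isT : 0 < 2)%N; rewrite !big_nat1 /= subn1 !sigma_small !sigma2; lra.
Qed.

Lemma tauR4 : tauR 4 = - 1472%:R.
Proof.
have := tauR_conv R (isT : 0 < 4)%N.
rewrite !(big_ltn (isT : 1 < 4)%N) !(big_ltn (isT : 2 < 4)%N) !(big_ltn (isT : 3 < 4)%N) !big_geq // /=.
rewrite !subSS !subn0 /= !sigma_small !sigma2 !sigma3 !sigma4; lra.
Qed.

Lemma sigma_2_11 : sigma 2 11 = 2049%:R.
Proof. rewrite sigma2; lra. Qed.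

Definition hecke_seq (q : nat) (u : nat -> R) (n : nat) : R :=
  u (q * n)%N + (if (q %| n)%N then q%:R ^+ 11 * u (n %/ q)%N else 0).

(** By [manin], tau is sigma_11 minus 691/36 times the divisor sum of [wsum]. The former has Hecke
    eigenvalue 1 + q^11, and the latter is mapped into its own span with sigma_11. *)
Lemma hecke_tau_sigma q : prime q -> exists x y : R, forall n, (0 < n)%N ->
  hecke_seq q tauR n = x * tauR n + y * sigma n 11.
Proof.
move=> qp; have q0 := prime_gt0 qp.
have [x [y hxy]] := wsum_cusp_hecke R qp.
exists x, (1 + q%:R ^+ 11 - x - 691%:R / 36%:R * y) => n n0.
have hD := dsum_hecke qp n0 hxy.
have hS : hecke_seq q (fun n => sigma n 11) n = (1 + q%:R ^+ 11) * sigma n 11.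
  rewrite /hecke_seq (@dsum_hecke R _ q (q%:R ^+ 11) 0 (1 + q%:R ^+ 11) n) ?mul0r ?add0r // => a a0.
  rewrite mul0r add0r natrM; case: ifPn => [/dvdnP[b ->]|_]; last by ring.
  by rewrite mulnK // natrM; ring.
have DE m : (0 < m)%N -> tauR m = sigma m 11 - 691%:R / 36%:R * dsum (wsum (@cusp_period R)) m.
  by move=> m0; have := manin R m0; lra.
have qn0 : (0 < q * n)%N by rewrite muln_gt0 q0.
rewrite -/(sigmaR R n 11) in hD; rewrite /hecke_seq in hS *.
rewrite (DE _ qn0) (DE _ n0); case: ifPn hD hS => [qn|qn] hD hS; last by lra.
by rewrite DE; [lra|rewrite divn_gt0 // dvdn_leq].
Qed.

(** The coefficient y of sigma_11 has to vanish. For q = 2 the values at n = 1, 2 show it; for odd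
    q, tau(2 q) is computed both from the relation for q at n = 2 and from that for 2 at n = q. *)
Lemma hecke_tauR q n : prime q -> (0 < n)%N -> hecke_seq q tauR n = tauR q * tauR n.
Proof.
have s1 : sigma 1 11 = 1 by exact: sigma_small.
have two (m : nat) : (0 < m)%N -> hecke_seq 2 tauR m = - 24%:R * tauR m.
  have [x [y h]] := hecke_tau_sigma (isT : prime 2); move=> m0.
  have := h 1%N isT; have := h 2%N isT; rewrite /hecke_seq /= divnn /= !muln1 addr0.
  rewrite sigma_2_11 s1 tauR4 tauR2 tauR1 => e2 e1.
  have y0 : y = 0 by lra.
  by rewrite -/(hecke_seq 2 tauR m) h // y0 mul0r addr0; congr (_ * _); lra.
move=> qp n0; have [->|q2] := eqVneq q 2%N; first by rewrite two // tauR2.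
have [x [y h]] := hecke_tau_sigma qp.
have q0 := prime_gt0 qp.
have ndvd m : (0 < m)%N -> (m <= 2)%N -> (q %| m)%N = false.
  move=> m0 m2; apply/negbTE/negP => /(dvdn_leq m0) qm.
  by have := prime_gt1 qp; lia.
have e1 := h 1%N isT; have e2 := h 2%N isT; have e3 := two q q0.
have q_odd : (2 %| q)%N = false.
  by apply/negbTE; rewrite dvdn_prime2 // eq_sym.
move: e1 e2 e3; rewrite /hecke_seq (ndvd 1%N isT isT) (ndvd 2%N isT isT) q_odd muln1 [(2 * q)%N]mulnC !addr0 s1 sigma_2_11 tauR2 tauR1.
move=> e1 e2 e3; have y0 : y = 0 by lra.
by rewrite -/(hecke_seq q tauR n) h // y0 mul0r addr0 e1 y0 mulr1 mul0r addr0.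
Qed.

End HeckeTau.

Lemma tau1 : tau 1 = 1.
Proof. by have := tauR1 rat; rewrite /tauR => /(intr_inj (x2 := 1)). Qed.

Lemma tau_mulp q n : prime q -> (0 < n)%N -> ~~ (q %| n)%N -> tau (q * n) = tau q * tau n.
Proof.
move=> qp n0 qn; have := @hecke_tauR rat q n qp n0.
by rewrite /hecke_seq (negPf qn) addr0 /tauR -rmorphM => /intr_inj.
Qed.

Lemma tau_mulpp q n : prime q -> (0 < n)%N -> ~~ (q %| n)%N ->
  tau (q * (q * n)) = (tau q ^+ 2 - q%:Z ^+ 11) * tau n.
Proof.
move=> qp n0 qn; have q0 := prime_gt0 qp.
have qn0 : (0 < q * n)%N by rewrite muln_gt0 q0.
have := @hecke_tauR rat q (q * n) qp qn0.
rewrite /hecke_seq dvdn_mulr // mulKn // /tauR (tau_mulp qp n0 qn).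
rewrite pmulrn -rmorphXn -!rmorphM -rmorphD => /intr_inj e.
by apply: (addIr (q%:Z ^+ 11 * tau n)); rewrite e; ring.
Qed.

Lemma tau_pp q : prime q -> tau (q * q) = tau q ^+ 2 - q%:Z ^+ 11.
Proof.
move=> qp; rewrite -{2}[q]muln1 tau_mulpp ?tau1 ?mulr1 // dvdn1.
by have := prime_gt1 qp; case: q {qp} => [|[|q]].
Qed.

(** * Sums of products in a finite field *)

Lemma sum_sqr_le (I : finType) (A : {set I}) (r : I -> nat) :
  ((\sum_(i in A) r i) ^ 2 <= #|A| * \sum_(i in A) r i ^ 2)%N.
Proof.
rewrite -(leq_pmul2l (isT : 0 < 2)%N) -mulnn big_distrlr /= big_distrr /=.
have -> : (2 * (#|A| * \sum_(i in A) r i ^ 2) =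
    \sum_(i in A) \sum_(j in A) (r i ^ 2 + r j ^ 2))%N.
  under [RHS]eq_bigr do rewrite big_split /= sum_nat_const.
  by rewrite big_split /= sum_nat_const -big_distrr /= mul2n addnn.
apply: leq_sum => i _; rewrite big_distrr /=; apply: leq_sum => j _.
exact: nat_Cauchy.
Qed.

(** Cauchy-Schwarz for the fibre sizes, whose squares count the collisions of f. *)
Lemma card_sqr_le (T T' : finType) (f : T -> T') (D : {set T}) :
  (#|D| ^ 2 <= #|f @: D| * \sum_(u in D) \sum_(v in D) (f u == f v))%N.
Proof.
pose r (s : T') := (\sum_(u in D) (f u == s))%N.
have -> : #|D| = (\sum_(s in f @: D) r s)%N.
  rewrite exchange_big /= -sum1_card; apply: eq_bigr => u uD.
  rewrite (bigD1 (f u)) ?imset_f //= eqxx big1 ?addn0 // => s /andP[_ /negPf su].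
  by rewrite eq_sym su.
apply: leq_trans (sum_sqr_le _ _) _; rewrite leq_mul2l; apply/orP; right.
rewrite (partition_big_imset f) /=; apply: eq_leq; apply: eq_bigr => s _.
rewrite -mulnn big_distrlr /= [RHS]big_mkcondr /=; apply: eq_bigr => u uD.
case: (eqVneq (f u) s) => [<-|_]; last by rewrite big1 // => v _; rewrite mul0n.
by apply: eq_bigr => v _; rewrite mul1n eq_sym.
Qed.

Section SumProduct.

Variable F : finFieldType.
Implicit Types (A B U V : {set F}).

Definition sumset U V := [set u + v | u in U, v in V].
Definition diffset U V := [set u - v | u in U, v in V].

(** Fix by [c] one representation d = u - v of each difference; the default (0, 0) occurs only
    outside the difference set. Then (d, w) -> (u + w, v + w) is injective, since d is the
    difference of the two entries. *)
Lemma ruzsa_triangle U V :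
  (#|diffset U V| * #|V| <= #|sumset U V| * #|sumset V V|)%N.
Proof.
set D := diffset U V; set S := sumset U V; set W := sumset V V.
pose c (d : F) : F * F := odflt (0, 0) [pick x : F * F | [&& x.1 \in U, x.2 \in V & d == x.1 - x.2]].
have cP d : d \in D -> [/\ (c d).1 \in U, (c d).2 \in V & d = (c d).1 - (c d).2].
  case/imset2P => u v uU vV ed; rewrite /c; case: pickP => [x /and3P[-> -> /eqP]//|/(_ (u, v))].
  by rewrite /= uU vV ed eqxx.
rewrite -!cardsX.
pose h (x : F * F) := ((c x.1).1 + x.2, (c x.1).2 + x.2).
rewrite -(card_in_imset (f := h)); last first.
  move=> [d w] [d' w'] /setXP[/= dD wV] /setXP[/= dD' wV'] [e1 e2].
  have [_ _ ed] := cP _ dD; have [_ _ ed'] := cP _ dD'.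
  have dd : d = d'.
    rewrite ed ed'; have -> : (c d).1 - (c d).2 = ((c d).1 + w) - ((c d).2 + w) by ring.
    by rewrite e1 e2; ring.
  by move: e1; rewrite dd => /addrI ->.
apply/subset_leq_card/subsetP => y /imsetP[[d w] /setXP[/= dD wV] ->].
by have [cU cV _] := cP _ dD; rewrite inE /= !imset2_f.
Qed.

Definition dilate_sum A B (xi : F) := [set a + xi * b | a in A, b in B].

Let energy A B (xi : F) : nat :=
  (\sum_(u in setX A B) \sum_(v in setX A B) (u.1 + xi * u.2 == v.1 + xi * v.2)%R)%N.

Let dilate_sumE A B xi : dilate_sum A B xi = (fun u : F * F => u.1 + xi * u.2) @: setX A B.
Proof.
apply/setP => s; apply/imset2P/imsetP => [[a b aA bB ->]|[[a b] /setXP[/= aA bB] ->]].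
  by exists (a, b) => //; apply/setXP.
by exists a b.
Qed.

(** The equations a - xi b = a' - xi b' and a + xi b' = a' + xi b are the same, so exchanging b and
    b' is a bijection of the solutions. *)
Let energyN A B xi : energy A B (- xi) = energy A B xi.
Proof.
rewrite /energy !pair_big_dep /=.
pose h (w : (F * F) * (F * F)) := ((w.1.1, w.2.2), (w.2.1, w.1.2)).
rewrite (reindex_inj (h := h)) /=; last first.
  by apply: (can_inj (g := h)) => -[[a b] [c d]].
apply: eq_big => [[[a b] [a' b']]|[[a b'] [a' b]] _] /=.
  by rewrite !inE /=; do !case: (_ \in _).
congr (nat_of_bool _); apply/eqP/eqP => e.
  have -> : a + xi * b' = (a + - xi * b) + xi * b + xi * b' by ring.
  by rewrite e; ring.
have -> : a + - xi * b = (a + xi * b') - xi * b' - xi * b by ring.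
by rewrite e; ring.
Qed.

(** A pair u = v collides for every xi, while a pair u != v collides for at most one xi. *)
Let sum_energy A B :
  (\sum_(xi : F | xi != 0%R) energy A B xi <= #|A| * #|B| * #|F| + (#|A| * #|B|) ^ 2)%N.
Proof.
have -> : (#|A| * #|B| * #|F| + (#|A| * #|B|) ^ 2 = \sum_(u in setX A B) (#|F| + #|setX A B|))%N.
  by rewrite sum_nat_const cardsX mulnDr mulnn.
rewrite /energy exchange_big /=.
apply: leq_sum => u uAB; rewrite exchange_big /= -[X in (_ <= _ + X)%N]sum1_card.
rewrite (bigD1 u) //= [X in (_ <= _ + X)%N](bigD1 u) //=.
apply: leq_add.
  by apply: leq_trans (leq_sum _ (E2 := fun=> 1%N) _) _ => [xi _|]; [case: eqP|rewrite sum1_card max_card].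
apply: leq_trans (leq_addl _ _); apply: leq_sum => v /andP[vAB vu].
have [b|b] := eqVneq u.2 v.2.
  rewrite big1 // => xi _; apply/eqP; rewrite eqb0 b (inj_eq (addIr _)).
  by apply: contra vu => /eqP e; apply/eqP; rewrite [u]surjective_pairing e b -surjective_pairing.
pose z := (u.1 - v.1) / (v.2 - u.2).
have uniqz xi : u.1 + xi * u.2 = v.1 + xi * v.2 -> xi = z.
  move=> e; rewrite /z; have d0 : v.2 - u.2 != 0 by rewrite subr_eq0 eq_sym.
  apply: (mulIf d0); rewrite divfK //.
  have -> : u.1 - v.1 = (u.1 + xi * u.2) - v.1 - xi * u.2 by ring.
  by rewrite e; ring.
apply: (@leq_trans (\sum_(xi : F) (xi == z))%N).
  rewrite big_mkcond; apply: leq_sum => xi _ /=; case: ifP => // _.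
  by case: eqP => // /uniqz ->; rewrite eqxx.
by rewrite -big_mkcond /= sum1_card; rewrite (eq_card (B := pred1 z)) ?card1.
Qed.

(** Let q be the order of F and x = |A| |B|. Some nonzero xi has energy at most the average (x q +
    x^2) / (q - 1), so Cauchy-Schwarz bounds the dilate sum below by x (q - 1) / (q + x), which
    exceeds q / 2 for x >= 2 q and q > 4. The same energy serves - xi. *)
Lemma large_dilate_sum A B : (4 < #|F|)%N -> (2 * #|F| <= #|A| * #|B|)%N ->
  exists2 xi : F, xi != 0 & (#|F| < 2 * #|dilate_sum A B xi|)%N /\
    (#|F| < 2 * #|dilate_sum A B (- xi)|)%N.
Proof.
move=> q3 hAB; set q := #|F| in q3 hAB *; set x := (#|A| * #|B|)%N in hAB.
have [xi xi0 hxi] : exists2 xi : F, xi != 0 & (energy A B xi * q.-1 <= x * q + x ^ 2)%N.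
  apply/exists_inP; apply: contraT; rewrite negb_exists_in => /forall_inP H.
  have := sum_energy A B; rewrite -/x -/q.
  have cq : #|[pred xi : F | xi != 0]| = q.-1.
    by have := cardC1 (0 : F); rewrite -/q => <-; apply: eq_card => y; rewrite !inE.
  have : (\sum_(xi : F | xi != 0%R) ((x * q + x ^ 2).+1) <= \sum_(xi : F | xi != 0%R) energy A B xi * q.-1)%N.
    by apply: leq_sum => xi xi0; rewrite ltnNge; apply: H.
  rewrite sum_nat_const cq -big_distrl /= => h1 h2.
  have := leq_trans h1 (leq_mul h2 (leqnn q.-1)).
  by rewrite mulnC leq_pmul2r ?ltnn //; lia.
exists xi => //.
have key z : energy A B z = energy A B xi -> (q < 2 * #|dilate_sum A B z|)%N.
  move=> ez; rewrite ltnNge; apply/negP => hS.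
  have := card_sqr_le (fun u : F * F => u.1 + z * u.2) (setX A B).
  rewrite -dilate_sumE cardsX -/x -/(energy A B z) ez => h.
  set E := energy A B xi in hxi h; set S := #|_| in hS h.
  have h1 : (2 * x ^ 2 * q.-1 <= q * (x * q + x ^ 2))%N.
    apply: (@leq_trans (2 * (S * E) * q.-1)); first by rewrite leq_mul2r leq_mul2l h !orbT.
    rewrite mulnA -mulnA; exact: leq_mul.
  have x0 : (0 < x)%N by lia.
  have h2 : (2 * x * q.-1 <= q * (q + x))%N.
    rewrite -(leq_pmul2l x0); apply: leq_trans (leq_trans _ h1) _.
      by rewrite -mulnn; lia.
    by rewrite -mulnn; lia.
  have q1 : q = q.-1.+1 by lia.
  have h3 : (2 * q * (q - 2) <= x * (q - 2))%N by rewrite leq_mul2r hAB orbT.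
  have h4 : (x * (q - 2) + x * q = 2 * x * q.-1)%N.
    by rewrite -mulnDr mulnAC mulnC; congr muln; lia.
  have h5 : (q * (2 * (q - 2)) <= q * q)%N by move: h2; rewrite mulnDr; lia.
  by move: h5; rewrite leq_pmul2l; lia.
by split; apply: key; rewrite // energyN.
Qed.

End SumProduct.

(** * Every residue as a sum of eight products *)

Section EightProducts.

Variable F : finFieldType.
Implicit Types (A B S T : {set F}).

Lemma large_sets_meet S T : (#|F| < #|S| + #|T|)%N -> exists2 s, s \in S & s \in T.
Proof.
move=> h; have h1 := cardsUI S T; have h2 : (#|S :|: T| <= #|F|)%N by apply: max_card.
have : (0 < #|S :&: T|)%N by lia.
by case/card_gt0P => s; rewrite inE => /andP[sS sT]; exists s.
Qed.

Lemma large_set_sum S la : (#|F| < 2 * #|S|)%N -> exists s s', [/\ s \in S, s' \in S & la = s + s'].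
Proof.
move=> h; have inj : injective (fun s : F => la - s) by move=> s s' /addrI/oppr_inj.
have [|s sS /imsetP[s' s'S e]] := @large_sets_meet S [set la - s | s in S].
  by rewrite (card_imset _ inj) addnn -mul2n.
by exists s, s'; split=> //; rewrite e subrK.
Qed.

(** The nonzero part of B splits into Bs, closed under negation, and Ba, whose negatives avoid B;
    one of them still has product at least 2 q with A. The xi of [large_dilate_sum] is then written
    as a quotient, so that a multiple of a + xi b becomes a sum of four products, and two such
    elements reach any residue. *)
Theorem eight_products A B la : (4 < #|F|)%N -> (8 * #|F| <= #|A| * #|B|)%N ->
  exists l : seq (F * F), [/\ size l = 8%N, forall x, x \in l -> x.1 \in A /\ x.2 \in B &
    la = \sum_(x <- l) x.1 * x.2].
Proof.
move=> q4 hAB; set q := #|F| in q4 hAB.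
pose Bs := [set b in B | (b != 0) && (- b \in B)].
pose Ba := [set b in B | (b != 0) && (- b \notin B)].
have qA : (#|A| <= q)%N by apply: max_card.
have hB : (#|B| <= (#|Bs| + #|Ba|).+1)%N.
  have disj : [disjoint Bs & Ba].
    by rewrite -setI_eq0; apply/eqP/setP => b; rewrite !inE; case: (- b \in B); rewrite ?andbF.
  have -> : (#|Bs| + #|Ba| = #|B :\ 0%R|)%N.
    rewrite -cardsUI (_ : Bs :&: Ba = set0); last by apply/eqP; rewrite setI_eq0.
    rewrite cards0 addn0; apply: eq_card => b; rewrite !inE.
    by case: (b \in B); case: (b != 0); case: (- b \in B).
  by rewrite (cardsD1 0 B); case: (0 \in B).
have B8 : (8 <= #|B|)%N.
  by rewrite leqNgt; apply/negP => B8; have := leq_mul qA (ltnW B8); nia.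
have : (2 * q <= #|A| * #|Bs|)%N \/ (2 * q <= #|A| * #|Ba|)%N.
  case: (leqP (2 * q) (#|A| * #|Bs|)) => [|hs]; first by left.
  case: (leqP (2 * q) (#|A| * #|Ba|)) => [|ha]; first by right.
  have : (#|A| * #|B| <= #|A| * (#|Bs| + #|Ba|).+1)%N by rewrite leq_mul2l hB orbT.
  by rewrite mulnS mulnDr; nia.
case=> [hs|ha].
  (* As |A| |Bs| > q, the map (a, b) -> a - xi b has a collision, whence xi = (a1 - a2) / (b1 - b2);
     the products with minus signs are allowed since Bs is symmetric. *)
  have [xi xi0 [S1 S2]] := large_dilate_sum q4 hs.
  have [[a1 b1] [[a2 b2] [u1 u2 e ne]]] : exists u v : F * F,
     [/\ u \in setX A Bs, v \in setX A Bs, u.1 - xi * u.2 = v.1 - xi * v.2 & u != v].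
    have [inj|] := boolP [forall u in setX A Bs, forall v in setX A Bs,
        (u.1 - xi * u.2 == v.1 - xi * v.2) ==> (u == v)].
      have : (#|[set (u.1 - xi * u.2)%R | u in setX A Bs]| <= q)%N by apply: max_card.
      move=> h; exfalso; move: h; rewrite card_in_imset ?cardsX.
        by move=> /(leq_trans hs); lia.
      move=> u v uX vX /eqP e; apply/eqP.
      by move/forall_inP/(_ _ uX)/forall_inP/(_ _ vX)/implyP: inj => /(_ e).
    rewrite negb_forall_in => /exists_inP[u uX]; rewrite negb_forall_in => /exists_inP[v vX].
    by rewrite negb_imply => /andP[/eqP e ne]; exists u, v.
  move: u1 u2 e ne => /setXP[/= a1A]; rewrite inE => /and3P[b1B _ nb1] /setXP[/= a2A].
  rewrite inE => /and3P[b2B _ nb2] e ne.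
  have b12 : b1 - b2 != 0.
    rewrite subr_eq0; apply: contra ne => /eqP b12; move: e; rewrite b12 => /addIr ->.
    by rewrite eqxx.
  have exi : (b1 - b2) * xi = a1 - a2.
    have -> : a1 - a2 = (a1 - xi * b1) + xi * b1 - a2 by ring.
    by rewrite e; ring.
  have [s [s' [/imset2P[a b aA bB ->] /imset2P[a' b' a'A b'B ->] es]]] :=
    large_set_sum (la / (b1 - b2)) S1.
  move: bB b'B; rewrite !inE => /and3P[bB _ nbB] /and3P[b'B _ nb'B].
  exists [:: (a, b1); (a, - b2); (a1, b); (a2, - b); (a', b1); (a', - b2); (a1, b'); (a2, - b')].
  split=> // [x|].
    by rewrite !inE; do ![case/orP]; move/eqP->.
  rewrite !big_cons big_nil /=.
  have -> : la = (b1 - b2) * (la / (b1 - b2)) by rewrite mulrC divfK.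
  rewrite es.
  have -> : (b1 - b2) * (a + xi * b + (a' + xi * b')) =
     (b1 - b2) * a + (b1 - b2) * a' + ((b1 - b2) * xi) * b + ((b1 - b2) * xi) * b' by ring.
  by rewrite exi; ring.
(* The set of the a - xi b has more than q / 2 elements, so it meets its negative, whence xi = (a1 +
   a2) / (b1 + b2). The denominator is nonzero because - b2 is not in B. *)
have [xi xi0 [S1 S2]] := large_dilate_sum q4 ha.
have [|s] := @large_sets_meet (dilate_sum A Ba (- xi)) [set - s | s in dilate_sum A Ba (- xi)].
  by rewrite (card_imset _ (@oppr_inj F)) addnn -mul2n.
move=> /imset2P[a1 b1 a1A + es] /imsetP[s' /imset2P[a2 b2 a2A + es'] ess].
rewrite !inE => /and3P[b1B b10 nb1] /and3P[b2B b20 nb2].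
have b12 : b1 + b2 != 0.
  by rewrite addr_eq0; apply: contra nb2 => /eqP <-.
have exi : (b1 + b2) * xi = a1 + a2.
  have -> : a1 + a2 = (a1 + - xi * b1) + xi * b1 + a2 by ring.
  by rewrite -es ess es'; ring.
have [t [t' [/imset2P[a b aA bB ->] /imset2P[a' b' a'A b'B ->] et]]] :=
  large_set_sum (la / (b1 + b2)) S1.
move: bB b'B; rewrite !inE => /and3P[bB _ _] /and3P[b'B _ _].
exists [:: (a, b1); (a, b2); (a1, b); (a2, b); (a', b1); (a', b2); (a1, b'); (a2, b')].
split=> // [x|].
  by rewrite !inE; do ![case/orP]; move/eqP->.
rewrite !big_cons big_nil /=.
have -> : la = (b1 + b2) * (la / (b1 + b2)) by rewrite mulrC divfK.
rewrite et.
have -> : (b1 + b2) * (a + xi * b + (a' + xi * b')) =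
   (b1 + b2) * a + (b1 + b2) * a' + ((b1 + b2) * xi) * b + ((b1 + b2) * xi) * b' by ring.
by rewrite exi; ring.
Qed.

End EightProducts.

(** * Residues represented by values of tau *)

Lemma size_le_fibers (T : eqType) (T' : finType) (f : T -> T') (s : seq T) (k : nat) :
  (forall c, (count (fun x => f x == c) s <= k)%N) ->
  (size s <= k * #|[set y in [seq f x | x <- s]]|)%N.
Proof.
move=> hk; set S := [set _ in _].
have -> : size s = (\sum_(c in S) count (fun x => f x == c) s)%N.
  under [RHS]eq_bigr => c _ do rewrite -sum1_count big_mkcond /=.
  rewrite exchange_big /= -sum1_size big_seq [RHS]big_seq; apply: eq_bigr => x xs.
  rewrite (bigD1 (f x)) /=; last by rewrite inE map_f.
  by rewrite eqxx big1 // => c /andP[_ /negPf]; rewrite eq_sym => ->.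
rewrite mulnC -sum_nat_const; exact: leq_sum.
Qed.

Section ModPrime.

Variable p : nat.
Hypothesis p_prime : prime p.

Let F : finFieldType := 'F_p.

Definition tauF (n : nat) : F := (tau n)%:~R.

Definition vals (f : nat -> F) (s : seq nat) : {set F} := [set y in [seq f x | x <- s]].

Lemma valsP f s y : reflect (exists2 x, x \in s & y = f x) (y \in vals f s).
Proof. by rewrite inE; apply: mapP. Qed.

Lemma vals_f f s x : x \in s -> f x \in vals f s.
Proof. by move=> xs; apply/valsP; exists x. Qed.

Lemma card_F : #|F| = p. Proof. exact: card_Fp. Qed.

Lemma tauF_mul q n : prime q -> (0 < n)%N -> ~~ (q %| n)%N -> tauF (q * n) = tauF q * tauF n.
Proof. by move=> qp n0 qn; rewrite /tauF tau_mulp // rmorphM. Qed.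

Lemma tauF_sqr q : prime q -> tauF (q * q) = tauF q ^+ 2 - q%:R ^+ 11.
Proof. by move=> qp; rewrite /tauF tau_pp // rmorphB !rmorphXn. Qed.

Lemma tauF_sqr_mul q n : prime q -> (0 < n)%N -> ~~ (q %| n)%N ->
  tauF (q * (q * n)) = tauF (q * q) * tauF n.
Proof. by move=> qp n0 qn; rewrite /tauF tau_mulpp // tau_pp // rmorphM. Qed.

Lemma natF_inj (a b : nat) : (0 < a <= p)%N -> (0 < b <= p)%N -> a%:R = b%:R :> F -> a = b.
Proof.
wlog ab : a b / (a <= b)%N.
  move=> W ha hb e; have [ab|/ltnW ba] := leqP a b; first exact: W.
  by apply/esym; apply: W.
move=> /andP[a0 ap] /andP[b0 bp] e.
have : (p %| b - a)%N by rewrite (dvdn_pcharf (pchar_Fp p_prime)) natrB // e subrr.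
have [/eqP|ba] := posnP (b - a); first by rewrite subn_eq0 => ba _; apply/eqP; rewrite eqn_leq ab.
by move/(dvdn_leq ba); lia.
Qed.

(** A fibre of the eleventh power consists of roots of X^11 - c. *)
Lemma size_le_pow11 (s : seq nat) : uniq s -> (forall q, q \in s -> (0 < q <= p)%N) ->
  (size s <= 11 * #|vals (fun q => q%:R ^+ 11) s|)%N.
Proof.
move=> us hs; apply: size_le_fibers => c.
rewrite -size_filter; set s' := filter _ _.
have : (size [seq (x%:R : F) | x <- s'] < size ('X^11 - c%:P : {poly F})%R)%N.
  apply: max_poly_roots.
  - by rewrite -size_poly_eq0 size_XnsubC.
  - apply/allP => y /mapP[x]; rewrite mem_filter => /andP[/eqP e _] ->.
    by rewrite rootE !hornerE e subrr.
  - rewrite map_inj_in_uniq ?filter_uniq // => x y; rewrite !mem_filter => /andP[_ xs] /andP[_ ys].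
    exact: natF_inj (hs _ xs) (hs _ ys).
by rewrite size_map size_XnsubC.
Qed.

Local Notation tauF2 := (fun q => tauF (q * q)%N).

Lemma card_pow11 (s : seq nat) (U V : {set F}) :
  (forall q, q \in s -> prime q) ->
  (forall q, q \in s -> tauF q ^+ 2 \in U) -> (forall q, q \in s -> tauF2 q \in V) ->
  vals (fun q => q%:R ^+ 11) s \subset diffset U V.
Proof.
move=> ps hU hV; apply/subsetP => y /valsP[q qs ->]; apply/imset2P.
exists (tauF q ^+ 2) (tauF2 q); rewrite ?hU ?hV //.
by rewrite tauF_sqr ?ps //; ring.
Qed.

Lemma card_diffset (U V : {set F}) : (#|diffset U V| <= #|U| * #|V|)%N.
Proof. by rewrite /diffset curry_imset2X -cardsX leq_imset_card. Qed.

(** The pair (tau(q), tau(q^2)) determines q^11 modulo p, and q^11 determines q up to 11 choices. *)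
Lemma size_le_tau_pair (s : seq nat) : uniq s ->
  (forall q, q \in s -> prime q) -> (forall q, q \in s -> (q <= p)%N) ->
  (size s <= 11 * (#|vals tauF s| * #|vals tauF2 s|))%N.
Proof.
move=> us ps hs.
have h := card_pow11 (U := [set x ^+ 2 | x in vals tauF s]) ps
  (fun q qs => imset_f _ (vals_f tauF qs)) (fun q qs => vals_f tauF2 qs).
have h1 := size_le_pow11 us (fun q qs => introT andP (conj (prime_gt0 (ps _ qs)) (hs _ qs))).
apply: leq_trans h1 _; rewrite leq_mul2l /=.
apply: leq_trans (subset_leq_card h) _; apply: leq_trans (card_diffset _ _) _.
by rewrite leq_mul2r leq_imset_card orbT.
Qed.

Definition rep (la : F) (k : nat) := exists L : seq nat,
  [/\ size L = k, (forall n, n \in L -> (0 < n <= p ^ 3)%N) & la = \sum_(n <- L) tauF n].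

Lemma rep_sum (T : eqType) (l : seq T) (f : T -> F) k :
  (forall x, x \in l -> rep (f x) k) -> rep (\sum_(x <- l) f x) (size l * k).
Proof.
elim: l => [|x l IH] h; first by exists [::]; split=> //; rewrite !big_nil.
have [L [sL bL eL]] := h x (mem_head _ _).
have [L' [sL' bL' eL']] := IH (fun y yl => h y (mem_behead (s := x :: l) yl)).
exists (L ++ L'); split.
- by rewrite size_cat sL sL' mulSn.
- by move=> n; rewrite mem_cat => /orP[]; [apply: bL|apply: bL'].
- by rewrite big_cons big_cat eL eL'.
Qed.

Lemma rep1 n : (0 < n <= p ^ 3)%N -> rep (tauF n) 1.
Proof.
move=> hn; exists [:: n]; split=> //; last by rewrite big_seq1.
by move=> m; rewrite inE => /eqP->.
Qed.

Lemma repD a b k l : rep a k -> rep b l -> rep (a + b) (k + l).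
Proof.
move=> [L [sL bL eL]] [L' [sL' bL' eL']]; exists (L ++ L'); split.
- by rewrite size_cat sL sL'.
- by move=> n; rewrite mem_cat => /orP[]; [apply: bL|apply: bL'].
- by rewrite big_cat eL eL'.
Qed.

Hypothesis p4 : (4 < p)%N.

Lemma rep_products (A B : {set F}) k :
  (8 * p <= #|A| * #|B|)%N -> (forall a b, a \in A -> b \in B -> rep (a * b) k) ->
  forall la, rep la (8 * k).
Proof.
move=> hAB hrep la.
have h4 : (4 < #|F|)%N by rewrite card_F.
have h8 : (8 * #|F| <= #|A| * #|B|)%N by rewrite card_F.
have [l [sl hl ->]] := eight_products la h4 h8.
by rewrite -sl; apply: rep_sum => x /hl[xA xB]; apply: hrep.
Qed.

Let cube_bound a b c : (0 < a <= p)%N -> (0 < b <= p)%N -> (0 < c <= p)%N ->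
  (0 < a * (b * c) <= p ^ 3)%N.
Proof.
move=> /andP[a0 ap] /andP[b0 bp] /andP[c0 cp]; rewrite !muln_gt0 a0 b0 c0 /=.
by rewrite !expnS expn0 muln1 leq_mul // leq_mul.
Qed.

Let prime_ndvd q r : prime q -> prime r -> q != r -> ~~ (q %| r)%N.
Proof. by move=> qp rp; rewrite dvdn_prime2. Qed.

(** * Colliding and non-colliding values of tau at primes *)

Section Core.

(** P1 and P2 supply at least M primes each and P3 the primes up to the square root of p from which
    B is built. K is the threshold for the doubling |V + V| / |V|. The constant 176 = 8 * 22
    combines the 8 of [eight_products], the 11 of [size_le_pow11] and a factor 2 for passing to half
    of a family. *)
Variables (P1 P2 P3 : seq nat) (K M : nat).
Hypotheses (u1 : uniq P1) (u2 : uniq P2) (u3 : uniq P3).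
Hypotheses (prime1 : forall q, q \in P1 -> prime q) (prime2 : forall q, q \in P2 -> prime q).
Hypothesis (prime3 : forall q, q \in P3 -> prime q).
Hypotheses (le1 : forall q, q \in P1 -> (q <= p)%N) (le2 : forall q, q \in P2 -> (q <= p)%N).
Hypothesis (le3 : forall r, r \in P3 -> (r * r <= p)%N).
Hypothesis (dis12 : forall q r, q \in P1 -> r \in P2 -> q != r).
Hypothesis (dis13 : forall q r, q \in P1 -> r \in P3 -> q != r).
Hypotheses (M1 : (M <= size P1)%N) (M2 : (M <= size P2)%N).
Hypothesis hKM : (176 * p <= K * M)%N.
Hypothesis hB : ((176 * K * p) ^ 2 * 11 <= M ^ 2 * size P3)%N.

Definition paired (s : seq nat) := [seq q <- s | has (fun r => (r != q) && (tauF r == tauF q)) s].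

Lemma pairedP s q : reflect (q \in s /\ exists r, [/\ r \in s, r != q & tauF r = tauF q]) (q \in paired s).
Proof.
rewrite mem_filter; apply: (iffP andP) => [[/hasP[r rs /andP[rq /eqP e]] qs]|[qs [r [rs rq e]]]].
  by split=> //; exists r.
by split=> //; apply/hasP; exists r; rewrite // rq e eqxx.
Qed.

Lemma size_unpaired s : uniq s -> (size s <= #|vals tauF s| + size (paired s))%N.
Proof.
move=> us; rewrite -(count_predC (fun q => has (fun r => (r != q) && (tauF r == tauF q)) s) s).
rewrite addnC -size_filter -[X in (_ + X <= _)%N]size_filter leq_add2r.
set s' := filter _ _.
have us' : uniq [seq tauF q | q <- s'].
  rewrite map_inj_in_uniq ?filter_uniq // => x y; rewrite !mem_filter /= => /andP[/hasPn hx xs] /andP[_ ys] e.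
  by apply/eqP; have := hx _ ys; rewrite -e eqxx andbT negbK eq_sym.
rewrite -(size_map tauF) -(card_uniqP us'); apply: subset_leq_card; apply/subsetP => y /mapP[x].
by rewrite mem_filter => /andP[_ xs] ->; apply: vals_f.
Qed.

(** The larger of the two value sets satisfies |P3| <= 11 |B|^2 by [size_le_tau_pair]. *)
Let B := if (#|vals tauF P3| <= #|vals tauF2 P3|)%N then vals tauF2 P3 else vals tauF P3.

Let p0 : (0 < p)%N. Proof. exact: prime_gt0. Qed.

Let K0 : (0 < K)%N.
Proof. by move: hKM; rewrite !lt0n; apply: contraTneq => ->; rewrite mul0n -ltnNge muln_gt0 p0. Qed.

Let bound1 q : q \in P1 -> (0 < q <= p)%N.
Proof. by move=> qP; rewrite prime_gt0 ?prime1 ?le1. Qed.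

Let bound2 q : q \in P2 -> (0 < q <= p)%N.
Proof. by move=> qP; rewrite prime_gt0 ?prime2 ?le2. Qed.

Let BP b : b \in B -> exists r, [/\ (0 < r <= p)%N, b = tauF r &
  forall q, q \in P1 -> ~~ (q %| r)%N].
Proof.
rewrite /B; case: ifP => _ /valsP[r rP ->].
  exists (r * r)%N; split=> //; first by rewrite muln_gt0 prime_gt0 ?prime3 //= le3.
  by move=> q qP; rewrite Euclid_dvdM ?prime1 // orbb; apply: prime_ndvd; [exact: prime1|exact: prime3|exact: dis13].
exists r; split=> //.
  rewrite prime_gt0 ?prime3 //=; apply: leq_trans (le3 rP).
  by rewrite leq_pmulr // prime_gt0 ?prime3.
by move=> q qP; apply: prime_ndvd; [exact: prime1|exact: prime3|exact: dis13].
Qed.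

Let cardB : (176 * K * p <= M * #|B|)%N.
Proof.
have h : (size P3 <= 11 * #|B| ^ 2)%N.
  have le3' q : q \in P3 -> (q <= p)%N.
    move=> qP; apply: leq_trans (le3 qP); by rewrite leq_pmulr // prime_gt0 ?prime3.
  apply: leq_trans (size_le_tau_pair u3 prime3 le3') _; rewrite leq_mul2l /= -mulnn /B.
  case: (leqP #|vals tauF P3| #|vals tauF2 P3|) => h; first by rewrite leq_mul2r h orbT.
  by rewrite leq_mul2l (ltnW h) orbT.
rewrite -(leq_exp2r _ _ (isT : 0 < 2)%N) [((M * _) ^ 2)%N]expnMn -(leq_pmul2r (isT : 0 < 11)%N).
apply: leq_trans hB _; rewrite -mulnA [(_ * 11)%N]mulnC leq_mul2l; by rewrite h orbT.
Qed.

(** The eight missing summands are tau(1) = 1. *)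
Let rep_pad la : rep (la - 8%:R) 8 -> rep la 16.
Proof.
move=> h; have -> : la = (la - 8%:R) + 8%:R by ring.
apply: (repD h (l := 8)); exists (nseq 8 1%N); split=> //.
  by move=> n; rewrite mem_nseq => /andP[_ /eqP->]; rewrite expn_gt0 p0.
by rewrite big_nseq /tauF tau1 /=; ring.
Qed.

(** Each product of a value at P1 with an element of B is one value of tau by multiplicativity, so
    eight products need eight values. *)
Lemma rep_unpaired : (M <= 2 * #|vals tauF P1|)%N -> forall la, rep la 16.
Proof.
move=> hA la; apply: rep_pad; rewrite -[8%N]muln1.
apply: (@rep_products (vals tauF P1) B).
  have : (16 * p <= 2 * #|vals tauF P1| * #|B|)%N.
    apply: (@leq_trans (M * #|B|)); last by rewrite leq_mul2r hA orbT.
    by apply: leq_trans cardB; rewrite leq_mul2r; apply/orP; right; move: K0; clear; lia.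
  by rewrite -mulnA; clear; lia.
move=> a b /valsP[q qP ->] /BP[r [/andP[r0 rp] -> hr]].
rewrite -tauF_mul ?prime1 ?hr //; apply: rep1.
have := @cube_bound q r 1; rewrite muln1; apply; rewrite ?r0 ?rp ?p0 //.
by rewrite prime_gt0 ?prime1 ?le1.
Qed.

(** Here (tau(q^2) + tau(q'^2)) tau(r) = tau(q^2 r) + tau(q'^2 r). *)
Lemma rep_sumset_sqr : (8 * p <= #|sumset (vals tauF2 (paired P1)) (vals tauF2 (paired P1))| *
   #|vals tauF (paired P2)|)%N -> forall la, rep la 16.
Proof.
move=> h la; apply: (rep_products (k := 2) h) => a b.
case/imset2P => x y /valsP[q /pairedP[qP _] ->] /valsP[q' /pairedP[q'P _] ->] ->.
move=> /valsP[r /pairedP[rP _] ->].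
have r0 := prime_gt0 (prime2 rP).
have term s : s \in P1 -> rep (tauF2 s * tauF r) 1.
  move=> sP; rewrite -tauF_sqr_mul ?prime1 //; last first.
    by apply: prime_ndvd; [exact: prime1|exact: prime2|exact: dis12].
  by apply: rep1; apply: cube_bound; (exact: bound1 || exact: bound2).
by rewrite mulrDl; apply: (repD (k := 1) (l := 1)); apply: term.
Qed.

(** A partner q' != q with the same residue gives tau(q)^2 tau(r) = tau(q q' r), where tau(q^2 r)
    alone would differ by the term q^11 tau(r). *)
Lemma rep_sumset_mixed : (8 * p <= #|sumset [set x ^+ 2 | x in vals tauF (paired P1)]
    (vals tauF2 (paired P1))| * #|B|)%N -> forall la, rep la 16.
Proof.
move=> h la; apply: (rep_products (k := 2) h) => a b.
case/imset2P => x y /imsetP[x' /valsP[q /pairedP[qP [q' [q'P qq' e]]] ->] ->].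
move=> /valsP[s /pairedP[sP _] ->] -> /BP[r [/andP[r0 rp] -> hr]].
rewrite mulrDl; apply: (repD (k := 1) (l := 1)).
  rewrite expr2 -{1}e -mulrA -tauF_mul ?prime1 ?hr // -tauF_mul ?prime1 ?muln_gt0 ?r0 ?prime_gt0 ?prime1 //.
    by apply: rep1; apply: cube_bound; (exact: bound1 || rewrite r0).
  by rewrite Euclid_dvdM ?prime1 // negb_or hr // andbT prime_ndvd ?prime1 // eq_sym.
rewrite -tauF_sqr_mul ?prime1 ?hr //.
by apply: rep1; apply: cube_bound; (exact: bound1 || rewrite r0).
Qed.

(** If |V + V| >= K |V|, then |V + V| |X| >= K M / 22 >= 8 p. Otherwise Ruzsa's inequality gives |U
    - V| <= K |U + V|; as U - V contains the eleventh powers, |U + V| >= M / (22 K), and the size of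
    B makes up 8 p. *)
Lemma rep_paired : (M <= 2 * size (paired P1))%N ->
  (M <= 22 * (#|vals tauF2 (paired P1)| * #|vals tauF (paired P2)|))%N ->
  forall la, rep la 16.
Proof.
move=> hQ hXV la; set V := vals tauF2 (paired P1) in hXV *; set X := vals _ _ in hXV.
pose U := [set x ^+ 2 | x in vals tauF (paired P1)].
have [hV|hV] := leqP (K * #|V|) #|sumset V V|.
  apply: rep_sumset_sqr; rewrite -/V -/X -(leq_pmul2l (isT : 0 < 22)%N).
  apply: (@leq_trans (K * M)); first by apply: leq_trans hKM; clear; lia.
  apply: (@leq_trans (K * (22 * (#|V| * #|X|)))); first by rewrite leq_mul2l hXV orbT.
  rewrite mulnCA leq_mul2l /= mulnA leq_mul2r hV orbT //.
apply: rep_sumset_mixed; rewrite -/U -/V.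
have V0 : (0 < #|V|)%N.
  rewrite lt0n; apply/eqP => v0; move: hV; rewrite v0 muln0; by rewrite ltn0.
have hUV : (#|diffset U V| <= #|sumset U V| * K)%N.
  rewrite -(leq_pmul2r V0); apply: leq_trans (ruzsa_triangle U V) _.
  by rewrite -mulnA leq_mul2l (ltnW hV) orbT.
have pp q : q \in paired P1 -> prime q by case/pairedP => /prime1.
have hD : (size (paired P1) <= 11 * #|diffset U V|)%N.
  have h1 := size_le_pow11 (filter_uniq _ u1 : uniq (paired P1)).
  apply: leq_trans (h1 _) _.
    by move=> q /pairedP[qP _]; rewrite prime_gt0 ?prime1 ?le1.
  rewrite leq_mul2l /=; apply: subset_leq_card.
  exact: card_pow11 pp (fun q qP => imset_f _ (vals_f tauF qP)) (fun q qP => vals_f tauF2 qP).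
have h2 : (M <= 22 * K * #|sumset U V|)%N by move: hQ hD hUV; clear; lia.
rewrite -(leq_pmul2l (isT : 0 < 22)%N) -(leq_pmul2l K0).
apply: (@leq_trans (M * #|B|)); first by apply: leq_trans cardB; clear; lia.
apply: (@leq_trans (22 * K * #|sumset U V| * #|B|)); first by rewrite leq_mul2r h2 orbT.
by rewrite -!mulnA mulnCA.
Qed.

End Core.

End ModPrime.

Lemma rep_core p P1 P2 P3 K M : prime p -> (4 < p)%N ->
  uniq P1 -> uniq P2 -> uniq P3 ->
  (forall q, q \in P1 -> prime q) -> (forall q, q \in P2 -> prime q) ->
  (forall q, q \in P3 -> prime q) ->
  (forall q, q \in P1 -> (q <= p)%N) -> (forall q, q \in P2 -> (q <= p)%N) ->
  (forall r, r \in P3 -> (r * r <= p)%N) ->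
  (forall q r, q \in P1 -> r \in P2 -> q != r) ->
  (forall q r, q \in P1 -> r \in P3 -> q != r) ->
  (forall q r, q \in P2 -> r \in P3 -> q != r) ->
  (M <= size P1)%N -> (M <= size P2)%N -> (176 * p <= K * M)%N ->
  ((176 * K * p) ^ 2 * 11 <= M ^ 2 * size P3)%N ->
  forall la : 'F_p, rep la 16.
Proof.
move=> pp p4 u1 u2 u3 pr1 pr2 pr3 le1 le2 le3 d12 d13 d23 M1 M2 hKM hB.
have d21 q r : q \in P2 -> r \in P1 -> q != r by move=> ? ?; rewrite eq_sym d12.
have [h1|h1] := leqP M (2 * #|vals (tauF p) P1|).
  exact: (rep_unpaired pp p4 u3 pr1 pr3 le1 le3 d13 hKM hB h1).
have [h2|h2] := leqP M (2 * #|vals (tauF p) P2|).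
  exact: (rep_unpaired pp p4 u3 pr2 pr3 le2 le3 d23 hKM hB h2).
have s1 : (M <= 2 * size (paired p P1))%N by have := size_unpaired p u1; lia.
have s2 : (M <= 2 * size (paired p P2))%N by have := size_unpaired p u2; lia.
have pair s : uniq s -> (forall q, q \in s -> prime q) -> (forall q, q \in s -> (q <= p)%N) ->
    (size (paired p s) <= 11 * (#|vals (tauF p) (paired p s)| *
       #|vals (fun q => tauF p (q * q)) (paired p s)|))%N.
  move=> us ps les; apply: (size_le_tau_pair pp (filter_uniq _ us)).
    by move=> q /pairedP[/ps].
  by move=> q /pairedP[/les].
have e1 := pair _ u1 pr1 le1; have e2 := pair _ u2 pr2 le2.
set X1 := #|vals (tauF p) (paired p P1)| in e1; set X2 := #|vals (tauF p) (paired p P2)| in e2.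
set V1 := #|_| in e1; set V2 := #|_| in e2.
have [h|h] := leqP M (22 * (V1 * X2)).
  exact: (rep_paired pp p4 u1 u3 pr1 pr2 pr3 le1 le2 le3 d12 d13 hKM hB s1 h).
have [h'|h'] := leqP M (22 * (V2 * X1)).
  exact: (rep_paired pp p4 u2 u3 pr2 pr1 pr3 le2 le1 le3 d21 d23 hKM hB s2 h').
(* The products (V1 X2) (V2 X1) and (X1 V1) (X2 V2) coincide, so both mixed products cannot lie
   below M / 22. This is the reason for two disjoint families. *)
have f1 : (M <= 22 * (X1 * V1))%N by lia.
have f2 : (M <= 22 * (X2 * V2))%N by lia.
have : (22 * (V1 * X2) * (22 * (V2 * X1)) < M * M)%N by apply: ltn_mul.
have := leq_mul f1 f2; rewrite (_ : 22 * (X1 * V1) * (22 * (X2 * V2)) =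
   22 * (V1 * X2) * (22 * (V2 * X1)))%N; last by lia.
by move=> g1 /(leq_ltn_trans g1); rewrite ltnn.
Qed.

(** * Choice of parameters and conclusion *)

Lemma exp2_dominates c d : (0 < d)%N ->
  exists I, forall i, (I <= i)%N -> (c * i ^ d <= 2 ^ i)%N.
Proof.
move=> d0; exists (d.+1 * (c * (2 * d.+1) ^ d).+1)%N => i hi.
(* With k about i / (d + 1), 2^i >= (2^k)^(d+1) >= k^(d+1), and one factor k pays for c and the
   constant in i^d. *)
set k := (i %/ d.+1)%N.
have hk : ((c * (2 * d.+1) ^ d).+1 <= k)%N by rewrite leq_divRL // mulnC.
have k0 : (0 < k)%N by apply: leq_trans hk.
have ik : (i <= 2 * d.+1 * k)%N.
  have := ltn_ceil i (ltn0Sn d); rewrite -/k => h.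
  by apply: (leq_trans (ltnW h)); rewrite mulnAC leq_mul2r; lia.
apply: (@leq_trans (c * (2 * d.+1 * k) ^ d)); first by rewrite leq_mul2l leq_exp2r ?ik ?orbT.
rewrite expnMn mulnA; apply: (@leq_trans (k * k ^ d)); first by rewrite leq_mul2r ltnW ?orbT.
rewrite -expnS; apply: (@leq_trans ((2 ^ k) ^ d.+1)).
  by rewrite leq_exp2r // ltnW // ltn_expl.
by rewrite -expnM leq_exp2l // leq_trunc_div.
Qed.

Lemma rep_large_prime : exists J, forall p, prime p -> (2 ^ J <= p)%N ->
  forall la : 'F_p, rep la 16.
Proof.
pose C := (176 * 176 * 32 * 32)%N.
have CE : C = (176 * 176 * 32 * 32)%N by [].
move: (C) CE => {}C CE.
(* The size of P3 must reach 11 C^2 j^4 and is at least 2^(i-1) / i: this explains the factor 2 and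
   the exponent 5, while 81 = 3^4 comes from j <= 3 i. *)
have [I HI] := @exp2_dominates (2 * (C ^ 2 * 11 * 81)) 5 isT.
exists (2 * I + 40)%N => p pp hp.
have p0 := prime_gt0 pp.
set j := trunc_log 2 p; set i := j./2.
have hj : (2 * I + 40 <= j)%N by apply: trunc_log_max.
have pj1 : (2 ^ j <= p)%N by apply: trunc_logP.
have pj2 : (p < 2 ^ j.+1)%N by apply: trunc_log_ltn.
have ij : (i.*2 <= j <= i.*2.+1)%N by rewrite /i; lia.
have hi : (I + 20 <= i)%N by lia.
have e5 : (2 * (C ^ 2 * 11 * 81) * i ^ 5 <= 2 ^ i)%N by apply: HI; lia.
have p4 : (4 < p)%N.
  by apply: leq_trans pj1; apply: (@leq_trans (2 ^ 3)); rewrite // leq_exp2l //; lia.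
(* The halves of P serve as P1 and P2; removing the primes up to 2^i keeps them disjoint from P3. As
   p <= 32 j h, this K gives K h >= 176 p. *)
pose P := [seq q <- prime_list (2 ^ j) | (2 ^ i < q)%N].
pose h := (size P)./2.
pose K := (176 * (32 * j))%N.
have uP : uniq P by rewrite !filter_uniq // iota_uniq.
have PP q : q \in P -> [/\ prime q, (q <= p)%N & (2 ^ i < q)%N].
  rewrite mem_filter mem_prime_list => /and3P[-> -> h2]; split=> //; exact: leq_trans pj1.
have P3P r : r \in prime_list (2 ^ i) -> prime r /\ (r <= 2 ^ i)%N.
  by rewrite mem_prime_list => /andP[].
have cP : uniq (take h P ++ drop h P) by rewrite cat_take_drop.
have tP q : q \in take h P -> q \in P by apply: mem_take.
have dP q : q \in drop h P -> q \in P by apply: mem_drop.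
have far q r : q \in P -> r \in prime_list (2 ^ i) -> q != r.
  by move=> /PP[_ _ h1] /P3P[_ h2]; rewrite neq_ltn (leq_ltn_trans h2 h1) orbT.
have i8 : (24 * i <= 2 ^ i)%N.
  apply: leq_trans e5; rewrite (expnSr i 4) mulnA leq_mul2r; apply/orP; right.
  have i1 : (1 <= i ^ 4)%N by rewrite expn_gt0; lia.
  apply: leq_trans (leq_mul (leqnn _) i1); rewrite muln1.
  have C1 : (1 <= C ^ 2)%N by rewrite expn_gt0 CE.
  by lia.
have p2j : (2 ^ j = 8 * 2 ^ (j - 3))%N by rewrite -[8%N]/(2 ^ 3)%N -expnD; congr expn; lia.
have j2i : (j * 2 ^ i <= 2 ^ (j - 3))%N.
  apply: (@leq_trans (2 ^ (j - 3 - i) * 2 ^ i)); last by rewrite -expnD subnK //; lia.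
  rewrite leq_mul2r; apply/orP; right.
  have : (2 ^ i <= 2 ^ (3 + (j - 3 - i)))%N by rewrite leq_exp2l //; lia.
  rewrite expnD => hh; lia.
have jj : (j <= 2 ^ (j - 3))%N by apply: leq_trans j2i; rewrite leq_pmulr // expn_gt0.
(* Chebyshev gives 4 * 2^(j-3) <= j (|P| + 2^i); the removed primes and the rounding in h cost at
   most 2^(j-3) each, and p < 16 * 2^(j-3). *)
have hM : (p <= 32 * j * h)%N.
  have := @prime_list_exp2 j; have -> : (0 < j)%N by lia.
  move=> /(_ isT).
  have -> : (2 ^ j.-1 = 4 * 2 ^ (j - 3))%N by rewrite -[4%N]/(2 ^ 2)%N -expnD; congr expn; lia.
  have sP : (size (prime_list (2 ^ j)) <= size P + 2 ^ i)%N.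
    rewrite -(count_predC (fun q => 2 ^ i < q)%N (prime_list (2 ^ j))) -size_filter leq_add2l.
    rewrite -size_filter -[X in (_ <= X)%N](size_iota 1); apply: uniq_leq_size.
      by rewrite !filter_uniq // iota_uniq.
    move=> q; rewrite !mem_filter !mem_iota /= -leqNgt => /and3P[qi qp _].
    by rewrite prime_gt0 // add1n ltnS.
  move=> g1; have g2 := leq_trans g1 (leq_mul (leqnn j) sP).
  rewrite mulnDr in g2.
  have sh : (size P <= 2 * h + 1)%N by rewrite /h; lia.
  have g3 := leq_mul (leqnn j) sh; rewrite mulnDr muln1 in g3.
  have -> : (32 * j * h = 16 * (j * (2 * h)))%N by lia.
  rewrite expnS p2j in pj2; lia.
have hP3 : (C ^ 2 * 11 * j ^ 4 <= size (prime_list (2 ^ i)))%N.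
  have i0 : (0 < i)%N by lia.
  rewrite -(leq_pmul2l i0) -(leq_pmul2l (isT : 0 < 2)%N).
  apply: (@leq_trans (2 ^ i)).
    apply: leq_trans e5; have : (j ^ 4 <= 81 * i ^ 4)%N.
      by rewrite -[81%N]/(3 ^ 4)%N -expnMn leq_exp2r //; lia.
    move=> jj4; rewrite expnS; apply: (@leq_trans (2 * (i * (C ^ 2 * 11 * (81 * i ^ 4))))).
      by rewrite leq_mul2l leq_mul2l leq_mul2l jj4 !orbT.
    by lia.
  apply: (@leq_trans (2 * 2 ^ i.-1)); first by rewrite -expnS prednK.
  by rewrite leq_mul2l /=; apply: prime_list_exp2.
have sT : size (take h P) = h by rewrite size_take /h; case: ifP => //; lia.
apply: (@rep_core p (take h P) (drop h P) (prime_list (2 ^ i)) K h) => //.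
- by move: cP; rewrite cat_uniq => /andP[].
- by move: cP; rewrite cat_uniq => /and3P[].
- by rewrite filter_uniq // iota_uniq.
- by move=> q /tP/PP[].
- by move=> q /dP/PP[].
- by move=> q /P3P[].
- by move=> q /tP/PP[].
- by move=> q /dP/PP[].
- move=> r /P3P[_ hr]; apply: leq_trans pj1; apply: (leq_trans (leq_mul hr hr)).
  by rewrite -expnD leq_exp2l //; lia.
- move=> q r qt rd; apply/eqP => e; move: cP; rewrite cat_uniq => /and3P[_ /hasPn/(_ r rd)].
  by rewrite -e qt.
- by move=> q r /tP; apply: far.
- by move=> q r /dP; apply: far.
- by rewrite sT.
- have hh : (h + h <= size P)%N by rewrite addnn -[X in (_ <= X)%N]odd_double_half leq_addl.
  by rewrite size_drop leq_subRL // (leq_trans (leq_addr _ _) hh).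
- by rewrite /K -mulnA leq_mul2l /= hM.
have h1 : (176 * K * p <= C * j ^ 2 * h)%N.
  apply: (@leq_trans (176 * K * (32 * j * h))); first by rewrite leq_mul2l hM orbT.
  rewrite /K CE -mulnn; lia.
apply: (@leq_trans ((C * j ^ 2 * h) ^ 2 * 11)); first by rewrite leq_mul2r leq_exp2r.
have -> : ((C * j ^ 2 * h) ^ 2 * 11 = h ^ 2 * (C ^ 2 * 11 * j ^ 4))%N.
  by clear; rewrite !expnS !expn0 !muln1; lia.
by rewrite leq_mul2l hP3 orbT.
Qed.

Theorem theorem3 (R : realType) (eps : R) (heps : 0 < eps) :
  exists C p0 : R, 0 < C /\
    forall p : nat, prime p -> p0 < p%:R ->
    forall lambda : int,
    exists n : 'I_16 -> nat,
      [/\ (forall i, (0 < n i)%N),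
          (\sum_(i < 16) tau (n i) = lambda %[mod p%:Z])%Z &
          (\max_(i < 16) n i)%N%:R <= C * p%:R `^ (3 + eps)].
Proof.
have [J HJ] := rep_large_prime.
(* All arguments are at most p^3, so the constant 1 and a threshold independent of [eps] suffice. *)
exists 1, (2 ^ J)%N%:R; split=> // p pp; rewrite ltr_nat => /ltnW hp la.
have [L [sL bL eL]] := HJ p pp hp la%:~R.
have inL (i : 'I_16) : nth 0%N L i \in L by rewrite mem_nth // sL.
exists (fun i => nth 0%N L i); split=> [i||].
- by have /andP[] := bL _ (inL i).
- apply/eqP; rewrite eqz_mod_dvd (dvdz_pcharf (pchar_Fp pp)) rmorphB rmorph_sum /= eL subr_eq0.
  by rewrite (big_nth 0%N) sL big_mkord.
rewrite mul1r; apply: (@le_trans _ _ (p ^ 3)%N%:R).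
  by rewrite ler_nat; apply/bigmax_leqP => i _; have /andP[] := bL _ (inL i).
rewrite natrX -powR_mulrn ?ler0n //; apply: ler_powR; first by rewrite ler1n prime_gt0.
by rewrite lerDl ltW.
Qed.
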